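(* Let $\mathcal A$ be a unital $C^*$-algebra and let $E$ be a bounded set in the standard Hilbert module $H_{\mathcal A}$. Then $$\chi^*(E)=\lambda(E)\le I^*(E)\le\alpha^*(E)\le2\chi^*(E)=2\lambda(E),$$ where $\chi^*,I^*,\alpha^*$ are the Hausdorff, Istrăţescu and Kuratowski measures of noncompactness with respect to the family of seminorms defining Troitsky's topology on $H_{\mathcal A}$, and $\lambda(E)$ is the infimum of all $\eta>0$ for which there is a free finitely generated submodule $L\le H_{\mathcal A}$ with $\sup_{x\in E}\inf_{y\in L}\|x-y\|<\eta$.
   Context: $H_{\mathcal A}$ is the set of sequences $x=(\xi_1,\xi_2,\dots)$, $\xi_j\in\mathcal A$, such that $\sum_j\xi_j^*\xi_j$ converges in norm, with inner product $\langle x,y\rangle=\sum_j\xi_j^*\eta_j$ for $y=(\eta_1,\eta_2,\dots)$ and norm $\|x\|=\|\langle x,x\rangle\|^{1/2}$. Bounded means norm bounded. Troitsky's seminorms. A countable system $X=\{x_i\}_{i\ge1}\subset H_{\mathcal A}$ is called $H_{\mathcal A}$-admissible if (1) for every $x\in H_{\mathcal A}$ the series $\sum_i\langle x,x_i\rangle\langle x_i,x\rangle$ converges in norm; (2) its sum is $\le\langle x,x\rangle$; (3) $\|x_i\|\le1$ for all $i$. For an $H_{\mathcal A}$-admissible $X$ and a countable collection $\Phi=\{\varphi_1,\varphi_2,\dots\}$ of states on $\mathcal A$ put $$p_{X,\Phi}(x)=\sqrt{\sup_{k}\sum_{i=k}^{\infty}|\varphi_k(\langle x,x_i\rangle)|^2},\qquad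 x\in H_{\mathcal A}.$$ These are seminorms with $p_{X,\Phi}(x)\le\|x\|$; they define Troitsky's topology. Measures of noncompactness. For bounded $E$ and a seminorm $p=p_{X,\Phi}$ with pseudometric $d(x,y)=p(x-y)$: $\chi_p(E)$ is the infimum of $\varepsilon>0$ such that $E$ is covered by finitely many balls $\{x:d(x,y_j)<\varepsilon\}$, $y_j\in H_{\mathcal A}$; $\alpha_p(E)$ is the infimum of $\varepsilon>0$ such that $E$ is a finite union of sets of $d$-diameter $<\varepsilon$; $I_p(E)$ is the supremum of $\varepsilon>0$ such that there is an infinite $S\subset E$ with $d(x,y)\ge\varepsilon$ for all distinct $x,y\in S$ (it is $0$ if there is no such $\varepsilon$). For $\mu\in\{\chi,\alpha,I\}$, $\mu^*(E)=\sup_{X,\Phi}\mu_{p_{X,\Phi}}(E)$ over all $H_{\mathcal A}$-admissible $X$ and all countable collections $\Phi$ of states. In the definition of $\lambda$ the submodules $L$ are Hilbert (closed) submodules; free finitely generated means isomorphic to $\mathcal A^n$ for some $n$. *)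

(* Defs.v *)
From HB Require Import structures.
From mathcomp Require Import all_boot all_order all_algebra complex.
From mathcomp Require Import all_classical all_reals all_analysis.
Set Implicit Arguments.
Unset Strict Implicit.
Unset Printing Implicit Defensive.
Import Order.TTheory GRing.Theory Num.Theory.
Import numFieldNormedType.Exports.
Local Open Scope classical_set_scope.
Local Open Scope ring_scope.

(* The multiplication is a field of the mixin, over a complete normed
   C-module: HB rejects a structure inheriting from both GRing.Algebra and
   CompleteNormedModule (missing join with Num.NumDomain).  The algebra
   structure is attached to the carrier afterwards, so that "a * b" and "1"
   denote cmul a b and cone.  Since cone != 0, the zero algebra is excluded. *)
HB.mixin Record isCStar (R : realType) A of CompleteNormedModule R[i] A := {
  cmul : A -> A -> A ;
  cone : A ;
  cmulA : associative cmul ;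
  cmul1l : left_id cone cmul ;
  cmul1r : right_id cone cmul ;
  cmulDl : left_distributive cmul +%R ;
  cmulDr : right_distributive cmul +%R ;
  cone_neq0 : cone != 0 ;
  cmulZl : forall (c : R[i]) (a b : A), c *: cmul a b = cmul (c *: a) b ;
  cmulZr : forall (c : R[i]) (a b : A), c *: cmul a b = cmul a (c *: b) ;
  star : A -> A ;
  starK : involutive star ;
  starD : {morph star : a b / a + b} ;
  starZ : forall (c : R[i]) (a : A), star (c *: a) = Num.conj c *: star a ;
  starM : forall a b : A, star (cmul a b) = cmul (star b) (star a) ;
  normM_le : forall a b : A, `|cmul a b| <= `|a| * `|b| ;
  norm_star : forall a : A, `|cmul (star a) a| = `|a| ^+ 2
}.

#[short(type="cstarAlgType")]
HB.structure Definition CStarAlgebra (R : realType) :=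
  {A of isCStar R A & CompleteNormedModule R[i] A}.

#[non_forgetful_inheritance]
HB.instance Definition _ (R : realType) (A : cstarAlgType R) :=
  GRing.Zmodule_isNzRing.Build (CStarAlgebra.sort A)
    cmulA cmul1l cmul1r cmulDl cmulDr cone_neq0.
#[non_forgetful_inheritance]
HB.instance Definition _ (R : realType) (A : cstarAlgType R) :=
  GRing.Lmodule_isLalgebra.Build R[i] (CStarAlgebra.sort A) (@cmulZl R A).
#[non_forgetful_inheritance]
HB.instance Definition _ (R : realType) (A : cstarAlgType R) :=
  GRing.Lalgebra_isAlgebra.Build R[i] (CStarAlgebra.sort A) (@cmulZr R A).

(* Norms over R[i] are R[i]-valued; rnorm is the same norm with values in R. *)
Definition rnorm (R : realType) (V : normedZmodType R[i]) (v : V) : R :=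
  complex.Re `|v|.

Section CStarAlgebraTheory.
Variables (R : realType) (A : cstarAlgType R).

Definition cpos (a : A) : Prop := exists c : A, a = star c * c.

Definition cle (a b : A) : Prop := cpos (b - a).

Definition is_state (phi : {scalar A}) : Prop :=
  (forall a : A, cpos a -> 0 <= phi a) /\
  ereal_sup [set (rnorm (phi a))%:E | a in [set a : A | rnorm a <= 1]] = 1%E.

End CStarAlgebraTheory.

Section StandardModule.
Variables (R : realType) (A : cstarAlgType R).
Implicit Types (x y : nat -> A) (E L : set (nat -> A)).

Definition HA : set (nat -> A) :=
  [set x | cvgn (series (fun j => star (x j) * x j))].

Definition hinner x y : A := limn (series (fun j => star (x j) * y j)).

Definition hnorm x : R := Num.sqrt (rnorm (hinner x x)).

Definition hbounded E : Prop := exists M : R, forall x, E x -> hnorm x <= M.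

(* H_A is a right A-module: (x a)_j = xi_j a. *)
Definition rscale (I : Type) (x : I -> A) (a : A) : I -> A := fun j => x j * a.

Definition hilbert_submodule L : Prop :=
  [/\ L `<=` HA,
      L 0,
      forall x y, L x -> L y -> L (x + y),
      forall x (a : A), L x -> L (rscale x a) &
      forall x, HA x ->
        (forall e : R, 0 < e -> exists2 y, L y & hnorm (x - y) < e) -> L x].

Definition fin_norm (n : nat) (u : 'I_n -> A) : R :=
  Num.sqrt (rnorm (\sum_(i < n) star (u i) * u i)).

(* T : A^n -> L is a bijective A-linear homeomorphism. *)
Definition free_fg L : Prop :=
  exists (n : nat) (T : ('I_n -> A) -> (nat -> A)),
    [/\ forall u v, T (u + v) = T u + T v,
        forall u (a : A), T (rscale u a) = rscale (T u) a,
        range T = L &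
        exists c C : R, [/\ 0 < c, 0 < C &
          forall u, c * fin_norm u <= hnorm (T u) <= C * fin_norm u]].

Definition lambda E : \bar R :=
  ereal_inf [set eta%:E | eta in [set eta : R | 0 < eta /\
    exists L, [/\ hilbert_submodule L, free_fg L &
      (ereal_sup [set ereal_inf [set (hnorm (x - y))%:E | y in L] | x in E]
         < eta%:E)%E]]].

(* All sequences are indexed from 0; a finite system X can be padded with
   zeros, and a finite collection of states by repetition, without changing
   the seminorm below. *)
Definition admissible (X : nat -> nat -> A) : Prop :=
  let S x := series (fun i => hinner x (X i) * hinner (X i) x) in
  [/\ forall i, HA (X i),
      forall x, HA x -> cvgn (S x),
      forall x, HA x -> cle (limn (S x)) (hinner x x) &
      forall i, hnorm (X i) <= 1].

Definition troitsky (X : nat -> nat -> A) (Phi : nat -> {scalar A}) x : \bar R :=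
  sqrte (ereal_sup (range (fun k : nat =>
    \sum_(k <= i <oo) ((rnorm (Phi k (hinner x (X i)))) ^+ 2)%:E)%E)).

End StandardModule.

Section MeasuresOfNoncompactness.
Variables (R : realType) (T : Type).
Variables (H : set T) (d : T -> T -> \bar R) (E : set T).

Definition hausdorff_mnc : \bar R :=
  ereal_inf [set e%:E | e in [set e : R | 0 < e /\
    exists (n : nat) (c : 'I_n -> T), (forall j, H (c j)) /\
      forall x, E x -> exists j, (d x (c j) < e%:E)%E]].

Definition diam (S : set T) : \bar R :=
  ereal_sup [set d z.1 z.2 | z in S `*` S].

Definition kuratowski_mnc : \bar R :=
  ereal_inf [set e%:E | e in [set e : R | 0 < e /\
    exists (n : nat) (S : 'I_n -> set T),
      E = \bigcup_j S j /\ forall j, (diam (S j) < e%:E)%E]].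

(* The adjoined 0 is the value when there is no such e. *)
Definition istratescu_mnc : \bar R :=
  ereal_sup (0%E |` [set e%:E | e in [set e : R | 0 < e /\
    exists S : set T, [/\ S `<=` E, infinite_set S &
      forall x y, S x -> S y -> x <> y -> (e%:E <= d x y)%E]]]).

End MeasuresOfNoncompactness.

Section TroitskyMeasures.
Variables (R : realType) (A : cstarAlgType R).
Local Notation dist := ((nat -> A) -> (nat -> A) -> \bar R).

Definition mnc_star (mu : dist -> set (nat -> A) -> \bar R) (E : set (nat -> A))
    : \bar R :=
  ereal_sup [set r | exists (X : nat -> nat -> A) (Phi : nat -> {scalar A}),
    [/\ admissible X, forall k, is_state (Phi k) &
        r = mu (fun x y => troitsky X Phi (x - y)) E]].

Definition chi_star := mnc_star (hausdorff_mnc (@HA R A)).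
Definition alpha_star := mnc_star (@kuratowski_mnc R (nat -> A)).
Definition I_star := mnc_star (@istratescu_mnc R (nat -> A)).

End TroitskyMeasures.

(* Main.v *)
Require Import Defs.
From HB Require Import structures.
From mathcomp Require Import all_boot all_order all_algebra complex.
From mathcomp Require Import all_classical all_reals all_analysis.
From mathcomp Require Import ring lra.

(** The equality of [chi_star] and [lambda] is proved by two opposite
estimates, the second of which also bounds [lambda] by [I_star]; the remaining
inequalities hold for each seminorm separately, as in any pseudometric space.

Upper bound ([hausdorff_le_lambda]). Let every point of E lie within eta of a
free finitely generated submodule L. Every Troitsky seminorm p is dominated by
the norm ([troitsky_le_hnorm]), so it suffices that bounded subsets of L are
totally bounded for p. If g is one of the generators of L, the inequality
|phi (a* c)|^2 <= phi (a* c c* a) for states ([state_cauchy_schwarz]) bounds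
the tails of the series defining p (g a) by |a|^2 times the tails of the norm
convergent series of <g, x_i><x_i, g>, uniformly in the states
([free_fg_tail]). What is left of p is a finite number of bounded functionals,
for which a grid of small cells gives a finite net
([uniform_tail_tot_bounded]).

Lower bound ([separating_seminorm]). If eta < lambda E, no submodule of
sequences supported in the first m coordinates is within eta of E. This gives
points x_0, x_1, ... of E and consecutive blocks of coordinates such that x_n
has norm greater than eta beyond the start of the n-th block and norm smaller
than delta beyond its end. Let X_n be the normalised restriction of x_n to the
n-th block. Vectors of norm at most 1 supported in consecutive blocks form an
admissible system ([block_admissible]), and a state phi_n taking the value
|h| at h = <z_n, z_n>, where z_n is that restriction, makes the n-th
coefficient of x_n greater than eta - delta, while every fixed y has small
n-th coefficients in the end. So x_n is far from y for large n: finitely many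
balls of radius less than eta - 2 delta do not cover E
([lambda_le_hausdorff]), and the x_n are pairwise far apart
([lambda_le_istratescu]).

The theory of C*-algebras that this uses is developed without spectra. An
element a is called positive ([psd]) if it is self-adjoint and
|t - a| <= t for some t >= 0; this is visibly a convex cone. The binomial
iteration gives square roots ([sqrt_1B]), and the unitary u + i sqrt(1 - u^2)
shows that squares of self-adjoint elements are positive, which makes the cone
closed and the norm monotone on it ([psd_sq], [psd_closed], [psd_le_norm]).
Kaplansky's argument then yields that star c * c is positive ([psd_cstar]), so
that positivity agrees with [cpos]. States attaining the norm of a positive
element come from the Hahn-Banach theorem, applied to the sublinear functional
a |-> inf {t | a + star a <= t} ([exists_state]). The Cauchy-Schwarz inequality
of the Hilbert module, in the operator form star <x, y> * <x, y> <= t <y, y>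
for <x, x> <= t, is [hinner_cauchy_schwarz_psd]. *)

Set Implicit Arguments.
Unset Strict Implicit.
Unset Printing Implicit Defensive.
Import Order.TTheory GRing.Theory Num.Theory.
Import numFieldNormedType.Exports.
Local Open Scope classical_set_scope.
Local Open Scope ring_scope.
Local Open Scope complex_scope.

(** * Real-valued norms and convergence *)

Section RealNorm.
Variables (R : realType) (V : normedZmodType R[i]).
Implicit Types (u v : V).

(** The norm of the underlying structures takes its values in R[i]; [rnorm] is its real version. *)
Lemma normE v : `|v| = (rnorm v)%:C.
Proof. by rewrite /rnorm RRe_real// ger0_real. Qed.

Lemma rnorm_ge0 v : 0 <= rnorm v.
Proof. by rewrite -ler0c -normE. Qed.

Lemma rnorm0 : rnorm (0 : V) = 0.
Proof. by rewrite /rnorm normr0. Qed.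

Lemma rnorm_eq0 v : rnorm v = 0 -> v = 0.
Proof. by move=> v0; apply/eqP; rewrite -normr_eq0 normE v0. Qed.

Lemma rnormN v : rnorm (- v) = rnorm v.
Proof. by rewrite /rnorm normrN. Qed.

Lemma rnormB u v : rnorm (u - v) = rnorm (v - u).
Proof. by rewrite -rnormN opprB. Qed.

Lemma ler_rnormD u v : rnorm (u + v) <= rnorm u + rnorm v.
Proof.
by rewrite -lecR rmorphD /= -!normE; apply: ler_normD.
Qed.

Lemma ler_rnormBD (w u v : V) : rnorm (u - v) <= rnorm (u - w) + rnorm (w - v).
Proof. by apply: le_trans (ler_rnormD _ _); rewrite addrA subrK. Qed.

End RealNorm.

Section RealNormModule.
Variables (R : realType) (V : normedModType R[i]).
Implicit Types (u v : V) (f : nat -> V).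

Lemma normcE_rnorm (c : R[i]) : `|c| = (rnorm c)%:C.
Proof. by rewrite /rnorm RRe_real// ger0_real. Qed.

Lemma rnormZ (c : R[i]) v : rnorm (c *: v) = rnorm c * rnorm v.
Proof.
by apply: complexI; rewrite rmorphM /= -normcE_rnorm -!normE normrZ.
Qed.

Lemma rnormR (t : R) : rnorm (t%:C) = `|t|.
Proof. by rewrite /rnorm normc_def /= expr0n addr0 sqrtr_sqr. Qed.

Lemma rnormZR (t : R) v : rnorm (t%:C *: v) = `|t| * rnorm v.
Proof. by rewrite rnormZ rnormR. Qed.

Lemma cvgn_rnormP f v : (f @ \oo --> v) <->
  forall e : R, 0 < e -> exists N, forall n, (N <= n)%N -> rnorm (f n - v) < e.
Proof.
split.
  move=> /cvgrPdist_lt fv e e0.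
  have [|N _ HN] := fv e%:C; first by rewrite ltcR.
  exists N => n Nn; have := HN n Nn.
  by rewrite /= normE ltcR rnormB.
move=> H; apply/cvgrPdist_lt => e e0.
have eE : e = (complex.Re e)%:C by rewrite RRe_real// gtr0_real.
have [|N HN] := H (complex.Re e); first by rewrite -ltcR -eE.
by exists N => // n /= Nn; rewrite eE normE ltcR rnormB HN.
Qed.

End RealNormModule.

(** Completeness, stated with the real-valued norm. *)
Lemma cvgn_cauchy (R : realType) (V : completeNormedModType R[i]) (f : nat -> V) :
  (forall e : R, 0 < e -> exists N, forall n m, (N <= n)%N -> (n <= m)%N ->
    rnorm (f m - f n) < e) -> cvgn f.
Proof.
move=> H; apply/cauchy_cvgP/cauchyP => e e0.
have eE : e = (complex.Re e)%:C by rewrite RRe_real// gtr0_real.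
have [|N HN] := H (complex.Re e); first by rewrite -ltcR -eE.
exists (f N); exists N => // n /= Nn.
by rewrite -ball_normE /= eE normE ltcR rnormB HN.
Qed.

(** * Algebra, limits and square roots in a C*-algebra *)

Section CStarBasics.
Variables (R : realType) (A : cstarAlgType R).
Implicit Types (a b c : A) (f g : nat -> A).

Lemma rnormM a b : rnorm (a * b) <= rnorm a * rnorm b.
Proof. by rewrite -lecR rmorphM /= -!normE; apply: normM_le. Qed.

Lemma rnorm_cstar a : rnorm (star a * a) = rnorm a ^+ 2.
Proof. by apply: complexI; rewrite rmorphXn /= -!normE; apply: norm_star. Qed.

Lemma star_starE a : star (star a) = a. Proof. exact: starK. Qed.

Lemma star_mulE a b : star (a * b) = star b * star a. Proof. exact: starM. Qed.

Lemma star0 : star (0 : A) = 0.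
Proof. by have := starZ (0 : R[i]) (0 : A); rewrite conjC0 !scale0r. Qed.

Lemma starN a : star (- a) = - star a.
Proof. by rewrite -scaleN1r starZ conjCN1 scaleN1r. Qed.

Lemma starB a b : star (a - b) = star a - star b.
Proof. by rewrite starD starN. Qed.

Lemma star1 : star (1 : A) = 1.
Proof. by rewrite -[LHS]mul1r -[X in X * _]star_starE -star_mulE mul1r star_starE. Qed.

Lemma conj_real_complex (t : R) : Num.conj (t%:C) = t%:C.
Proof. by apply: conj_Creal; rewrite complex_real. Qed.

Lemma starZR (t : R) a : star (t%:C *: a) = t%:C *: star a.
Proof. by rewrite starZ conj_real_complex. Qed.

Lemma rnorm_star a : rnorm (star a) = rnorm a.
Proof.
have H b : rnorm b <= rnorm (star b).
  have [->|b0] := eqVneq b 0; first by rewrite star0.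
  have b1 : 0 < rnorm b.
    by rewrite lt_neqAle rnorm_ge0 eq_sym andbT; apply: contraNneq b0 => /rnorm_eq0->.
  by rewrite -(ler_pM2r b1) -expr2 -rnorm_cstar rnormM.
by apply/eqP; rewrite eq_le -{2}(star_starE a) !H.
Qed.

Lemma rnorm1 : rnorm (1 : A) = 1.
Proof.
have := rnorm_cstar 1; rewrite star1 mul1r.
have t0 : rnorm (1 : A) != 0.
  by apply/eqP => /rnorm_eq0/eqP; rewrite oner_eq0.
move: (rnorm (1 : A)) t0 => t t0 /eqP.
by rewrite expr2 -{1}[t]mulr1 (inj_eq (mulfI t0)) eq_sym => /eqP.
Qed.

Lemma rnorm_sa a : star a = a -> rnorm (a * a) = rnorm a ^+ 2.
Proof. by move=> sa; rewrite -rnorm_cstar sa. Qed.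

Lemma cvgn_bounded f a : (f @ \oo --> a) ->
  exists N, forall n, (N <= n)%N -> rnorm (f n) <= rnorm a + 1.
Proof.
move=> /cvgn_rnormP/(_ 1 ltr01)[N HN]; exists N => n /HN h.
by rewrite -[f n](subrK a) addrC; apply: le_trans (ler_rnormD _ _) _; rewrite lerD2l ltW.
Qed.

Lemma cvgn_mul f g a b : (f @ \oo --> a) -> (g @ \oo --> b) ->
  (fun n => f n * g n) @ \oo --> a * b.
Proof.
move=> fa gb; apply/cvgn_rnormP => e e0.
have [N1 H1] := cvgn_bounded fa.
have Ka : 0 < rnorm a + 1 by rewrite ltr_wpDl// rnorm_ge0.
have Kb : 0 < rnorm b + 1 by rewrite ltr_wpDl// rnorm_ge0.
have [|N2 H2] := (cvgn_rnormP f a).1 fa (e / 2 / (rnorm b + 1)); first by rewrite !divr_gt0.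
have [|N3 H3] := (cvgn_rnormP g b).1 gb (e / 2 / (rnorm a + 1)); first by rewrite !divr_gt0.
exists (maxn N1 (maxn N2 N3)) => n; rewrite !geq_max => /and3P[n1 n2 n3].
have -> : f n * g n - a * b = f n * (g n - b) + (f n - a) * b.
  by rewrite mulrBr mulrBl addrA subrK.
apply: le_lt_trans (ler_rnormD _ _) _; rewrite (splitr e).
have {}H1 := H1 _ n1; have {}H2 := H2 _ n2; have {}H3 := H3 _ n3.
apply: ltr_leD.
  apply: le_lt_trans (rnormM _ _) _.
  apply: le_lt_trans (ler_wpM2r (rnorm_ge0 _) H1) _.
  by rewrite mulrC -ltr_pdivlMr.
apply: le_trans (rnormM _ _) _.
apply: le_trans (_ : rnorm (f n - a) * (rnorm b + 1) <= _).
  by rewrite ler_wpM2l ?rnorm_ge0// lerDl.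
by rewrite -ler_pdivlMr// ltW.
Qed.

Lemma cvgn_star f a : (f @ \oo --> a) -> (fun n => star (f n)) @ \oo --> star a.
Proof.
move=> /cvgn_rnormP fa; apply/cvgn_rnormP => e /fa[N HN]; exists N => n /HN.
by rewrite -starB rnorm_star.
Qed.

Lemma cvgn_uniq f a b : (f @ \oo --> a) -> (f @ \oo --> b) -> a = b.
Proof. by move=> fa fb; apply: (cvg_unique _ fa fb); exact: norm_hausdorff. Qed.

Lemma cvgn_rnorm f a : (f @ \oo --> a) ->
  (fun n => rnorm (f n) : R) @ \oo --> (rnorm a : R).
Proof.
move=> /cvgn_rnormP fa; apply/cvgrPdist_lt => e /fa[N HN]; exists N => // n /= /HN h.
apply: le_lt_trans h; rewrite ler_norml; apply/andP; split.
  rewrite lerNl opprB lerBlDr; apply: le_trans (ler_rnormD _ _).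
  by rewrite subrK.
rewrite lerBlDr rnormB; apply: le_trans (ler_rnormD _ _).
by rewrite subrK.
Qed.

Lemma cvgn_rnorm_le f a (r : R) (N : nat) : (f @ \oo --> a) ->
  (forall n, (N <= n)%N -> rnorm (f n) <= r) -> rnorm a <= r.
Proof.
move=> /cvgn_rnorm fa H; rewrite -(cvg_lim _ fa)//; apply: limr_le; first by apply: cvgP fa.
by exists N => // n /= /H.
Qed.

(** Scalar majorant of the iteration [sqrt_it]: r' = (1 + r^2) / 2 from 0, which increases to 1. *)
Fixpoint sqrt_maj (n : nat) : R :=
  if n is m.+1 then 2^-1 * (1 + sqrt_maj m ^+ 2) else 0.

Lemma sqrt_maj_itv n : 0 <= sqrt_maj n <= 1.
Proof.
elim: n => [|n /andP[r0 r1]] /=; first by rewrite lexx ler01.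
have : sqrt_maj n ^+ 2 <= 1 by rewrite expr_le1.
have : 0 <= sqrt_maj n ^+ 2 by rewrite sqr_ge0.
by move=> *; apply/andP; split; lra.
Qed.

Lemma sqrt_maj_incr n : sqrt_maj n <= sqrt_maj n.+1.
Proof. by have := sqr_ge0 (sqrt_maj n - 1); rewrite /=; nra. Qed.

Lemma sqrt_maj_cauchy (e : R) : 0 < e ->
  exists N, forall n m, (N <= n)%N -> (n <= m)%N -> sqrt_maj m - sqrt_maj n < e.
Proof.
move=> e0.
have incr : nondecreasing_seq sqrt_maj by apply/nondecreasing_seqP/sqrt_maj_incr.
have cv : cvgn sqrt_maj.
  apply: nondecreasing_is_cvgn => //.
  by exists 1 => _ [n _ <-]; have /andP[] := sqrt_maj_itv n.
have /cvgrPdist_lt/(_ e e0)[N _ HN] := cv.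
exists N => n m Nn nm.
have h1 := nondecreasing_cvgn_le incr cv m.
have := HN n Nn; rewrite /= ger0_norm; last first.
  by rewrite subr_ge0; exact: (nondecreasing_cvgn_le incr cv).
by apply: le_lt_trans; rewrite lerD2r.
Qed.

Section SqrtIteration.
Variables (x : A) (x1 : rnorm x <= 1).

(** The iteration y' = (x + y^2) / 2 from 0; a limit y satisfies (1 - y)^2 = 1 - x. *)
Fixpoint sqrt_it (n : nat) : A :=
  if n is m.+1 then (2^-1 : R)%:C *: (x + sqrt_it m * sqrt_it m) else 0.

Lemma rnorm_half a : rnorm ((2^-1 : R)%:C *: a) = 2^-1 * rnorm a.
Proof. by rewrite rnormZR ger0_norm// invr_ge0. Qed.

Lemma sqrt_it_le n : rnorm (sqrt_it n) <= sqrt_maj n.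
Proof.
elim: n => [|n IH]; first by rewrite /= rnorm0.
rewrite [sqrt_it _]/= [sqrt_maj _]/= rnorm_half ler_pM2l ?invr_gt0//.
apply: le_trans (ler_rnormD _ _) (lerD x1 _).
by apply: le_trans (rnormM _ _) _; rewrite expr2 ler_pM ?rnorm_ge0.
Qed.

(** The steps of [sqrt_it] are bounded by those of the majorant because
z^2 - y^2 = z (z - y) + (z - y) y. *)
Lemma sqrt_it_step n : rnorm (sqrt_it n.+1 - sqrt_it n) <= sqrt_maj n.+1 - sqrt_maj n.
Proof.
elim: n => [|n IH].
  rewrite /= mulr0 expr0n /= !addr0 subr0 rnorm_half subr0.
  by rewrite ler_pM2l ?invr_gt0.
set z := sqrt_it n.+1 in IH *; set y := sqrt_it n in IH *.
have -> : sqrt_it n.+2 - z = (2^-1 : R)%:C *: (z * (z - y) + (z - y) * y).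
  rewrite mulrBl mulrBr addrA subrK.
  rewrite {2}/z [sqrt_it n.+1]/= -/y [sqrt_it n.+2]/= -scalerBr -/y; congr (_ *: _).
  rewrite -/(sqrt_it n.+1) -/z.
  by rewrite opprD addrACA subrr add0r.
have -> : sqrt_maj n.+2 - sqrt_maj n.+1 = 2^-1 *
    (sqrt_maj n.+1 * (sqrt_maj n.+1 - sqrt_maj n) + (sqrt_maj n.+1 - sqrt_maj n) * sqrt_maj n).
  rewrite [sqrt_maj n.+2]/= -/(sqrt_maj n.+1).
  by set r := sqrt_maj n.+1; rewrite {2}/r [sqrt_maj n.+1]/=; field.
rewrite rnorm_half ler_pM2l ?invr_gt0//.
apply: le_trans (ler_rnormD _ _) _.
by apply: lerD; apply: le_trans (rnormM _ _) _; rewrite ler_pM ?rnorm_ge0// sqrt_it_le.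
Qed.

Lemma sqrt_it_dist n m : (n <= m)%N ->
  rnorm (sqrt_it m - sqrt_it n) <= sqrt_maj m - sqrt_maj n.
Proof.
move=> /subnKC <-; elim: (m - n)%N => [|k IH]; first by rewrite addn0 !subrr rnorm0.
rewrite addnS; apply: le_trans (ler_rnormBD (sqrt_it (n + k)) _ _) _.
by apply: le_trans (lerD (sqrt_it_step _) IH) _; rewrite addrA subrK.
Qed.

Lemma sqrt_it_cvg : cvgn sqrt_it.
Proof.
apply: cvgn_cauchy => e /sqrt_maj_cauchy[N HN]; exists N => n m Nn nm.
by apply: le_lt_trans (sqrt_it_dist nm) _; exact: HN.
Qed.

End SqrtIteration.

Lemma cvgn_comm f a z : (f @ \oo --> a) -> (forall n, f n * z = z * f n) ->
  a * z = z * a.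
Proof.
move=> fa fz; apply: (@cvgn_uniq (fun n => f n * z)).
  by apply: cvgn_mul => //; exact: cvg_cst.
by under eq_fun do rewrite fz; apply: cvgn_mul => //; exact: cvg_cst.
Qed.

Lemma scaleC_half a : (2^-1 : R)%:C *: (a + a) = a.
Proof.
by rewrite scalerDr -scalerDl -rmorphD /= (_ : 2^-1 + 2^-1 = 1 :> R) ?scale1r//; field.
Qed.

(** The square root of 1 - x, for x self-adjoint in the closed unit ball. It
commutes with everything that commutes with x. *)
Lemma sqrt_1B x : star x = x -> rnorm x <= 1 -> exists b,
  [/\ star b = b, b * b = 1 - x, rnorm (1 - b) <= 1 &
      forall z, x * z = z * x -> b * z = z * b].
Proof.
move=> sx x1; have /= cv := sqrt_it_cvg x1.
set y := limn (sqrt_it x); have {}cv : sqrt_it x @ \oo --> y := cv.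
have y1 : rnorm y <= 1.
  apply: (cvgn_rnorm_le (N := 0) cv) => n _; apply: le_trans (sqrt_it_le x1 n) _.
  by have /andP[] := sqrt_maj_itv n.
have sy : star y = y.
  apply: (cvgn_uniq (cvgn_star cv)); rewrite (_ : (fun n => _) = sqrt_it x)//.
  apply/funext; elim=> [|n IH]; first exact: star0.
  by rewrite /= starZR starD star_mulE IH sx.
have yE : y = (2^-1 : R)%:C *: (x + y * y).
  apply: (@cvgn_uniq (fun n => sqrt_it x n.+1)); first by rewrite cvg_shiftS.
  apply: cvgZ; first exact: cvg_cst.
  by apply: cvgD; [exact: cvg_cst | exact: cvgn_mul].
have y2 : y + y = x + y * y by rewrite {1 2}yE -scalerDr scaleC_half.
exists (1 - y); split.
- by rewrite starB star1 sy.
- have xE : x = y + y - y * y by rewrite y2 addrK.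
  rewrite mulrBl !mulrBr !mul1r mulr1 [in RHS]xE !opprB opprD !addrA.
  by rewrite [1 + y * y - y]addrAC.
- by rewrite subKr.
- move=> z xz; rewrite mulrBl mulrBr mul1r mulr1; congr (_ - _).
  apply: (cvgn_comm cv); elim=> [|n IH] /=; first by rewrite mul0r mulr0.
  rewrite -scalerAl -scalerAr mulrDl mulrDr xz; congr (_ *: (_ + _)).
  by rewrite -mulrA IH mulrA IH mulrA.
Qed.

End CStarBasics.

(** * The positive cone *)

Section Psd.
Variables (R : realType) (A : cstarAlgType R).
Implicit Types (a b c p q u x z : A) (s t : R).

(** Positivity, in a form that does not mention the spectrum: a is self-adjoint
and |t - a| <= t for some real t >= 0. Real scalars are embedded in A as
[t%:C *: 1]. *)
Definition psd a : Prop :=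
  star a = a /\ exists2 t : R, 0 <= t & rnorm (t%:C *: 1 - a) <= t.

Lemma star_sc t : star (t%:C *: (1 : A)) = t%:C *: 1.
Proof. by rewrite starZR star1. Qed.

Lemma rnorm_sc t : rnorm (t%:C *: (1 : A)) = `|t|.
Proof. by rewrite rnormZR rnorm1 mulr1. Qed.

Lemma scD s t : (s + t)%:C *: (1 : A) = s%:C *: 1 + t%:C *: 1.
Proof. by rewrite rmorphD scalerDl. Qed.

Lemma scB s t : (s - t)%:C *: (1 : A) = s%:C *: 1 - t%:C *: 1.
Proof. by rewrite rmorphB scalerBl. Qed.

(** A bound witnessing positivity can be enlarged. *)
Lemma psd_bound_mono t s a : t <= s -> rnorm (t%:C *: 1 - a) <= t ->
  rnorm (s%:C *: 1 - a) <= s.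
Proof.
move=> ts H; have -> : s%:C *: 1 - a = (s - t)%:C *: 1 + (t%:C *: 1 - a).
  by rewrite scB addrA subrK.
apply: le_trans (ler_rnormD _ _) _; rewrite rnorm_sc ger0_norm ?subr_ge0//.
by rewrite -lerBrDl opprB addrCA subrr addr0.
Qed.

Lemma psd0 : psd 0.
Proof. by split; [exact: star0 | exists 0; rewrite // scale0r subr0 rnorm0]. Qed.

Lemma psdD a b : psd a -> psd b -> psd (a + b).
Proof.
move=> [sa [t t0 ta]] [sb [s s0 sb']]; split; first by rewrite starD sa sb.
exists (t + s); first exact: addr_ge0.
by rewrite scD opprD addrACA; apply: le_trans (ler_rnormD _ _) _; exact: lerD.
Qed.

Lemma psdZ s a : 0 <= s -> psd a -> psd (s%:C *: a).
Proof.
move=> s0 [sa [t t0 ta]]; split; first by rewrite starZR sa.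
exists (s * t); first exact: mulr_ge0.
by rewrite rmorphM -scalerA -scalerBr rnormZR ger0_norm// ler_wpM2l.
Qed.

Lemma psd_sum (I : Type) (r : seq I) (P : pred I) (F : I -> A) :
  (forall i, P i -> psd (F i)) -> psd (\sum_(i <- r | P i) F i).
Proof. by move=> H; apply: big_ind => //; [exact: psd0 | exact: psdD]. Qed.

Lemma psd_sc t : 0 <= t -> psd (t%:C *: 1).
Proof.
move=> t0; split; first exact: star_sc.
by exists t => //; rewrite subrr rnorm0.
Qed.

(** A self-adjoint element is below any real bound of its norm. *)
Lemma psd_sc_sub t a : star a = a -> rnorm a <= t -> psd (t%:C *: 1 - a).
Proof.
move=> sa at_; have t0 : 0 <= t by exact: le_trans (rnorm_ge0 _) at_.
split; first by rewrite starB star_sc sa.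
by exists t => //; rewrite subKr.
Qed.

Lemma sqrt_sc_sub t a : 0 < t -> star a = a -> rnorm a <= t -> exists b,
  [/\ psd b, b * b = t%:C *: 1 - a &
      forall z, a * z = z * a -> b * z = z * b].
Proof.
move=> t0 sa at_.
have tn0 : t%:C != 0 by rewrite (inj_eq (@complexI R)) gt_eqF.
have tE : (Num.sqrt t)%:C * (Num.sqrt t)%:C = t%:C.
  by rewrite -rmorphM /= -expr2 sqr_sqrtr// ltW.
(* sqrt (t - a) = sqrt t * sqrt (1 - a / t) *)
pose x := (t^-1)%:C *: a.
have [||b [sb bb b1 cb]] := @sqrt_1B R A x.
- by rewrite starZR sa.
- by rewrite rnormZR ger0_norm ?invr_ge0 ?(ltW t0)// mulrC ler_pdivrMr// mul1r.
exists ((Num.sqrt t)%:C *: b); split.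
- split; first by rewrite starZR sb.
  exists (Num.sqrt t); first exact: sqrtr_ge0.
  by rewrite -scalerBr rnormZR ger0_norm ?sqrtr_ge0// -[leRHS]mulr1 ler_wpM2l ?sqrtr_ge0.
- rewrite -scalerAl -scalerAr scalerA tE bb scalerBr; congr (_ - _).
  by rewrite scalerA -rmorphM /= mulfV ?gt_eqF// scale1r.
- move=> z az; rewrite -scalerAl -scalerAr cb// /x -scalerAl -scalerAr az//.
Qed.

Lemma psd_sqrt a : psd a -> exists b,
  [/\ psd b, b * b = a & forall z, a * z = z * a -> b * z = z * b].
Proof.
move=> [sa [t t0 ta]].
have t10 : 0 < t + 1 by rewrite ltr_wpDl.
have H : rnorm ((t + 1)%:C *: 1 - a) <= t + 1 by apply: psd_bound_mono ta; rewrite lerDl.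
have [|b [pb bb cb]] := sqrt_sc_sub t10 _ H; first by rewrite starB star_sc sa.
exists b; split => //; first by rewrite bb subKr.
move=> z az; apply: cb; rewrite mulrBl mulrBr az; congr (_ - _).
by rewrite -scalerAl -scalerAr mul1r mulr1.
Qed.

Lemma rnorm_ii : rnorm ('i%C : R[i]) = 1.
Proof. by rewrite /rnorm normc_def /= expr0n expr1n add0r sqrtr1. Qed.

Lemma mul_ii : 'i%C * 'i%C = -1 :> R[i].
Proof. by rewrite -expr2 sqr_i. Qed.

Lemma star_ii a : star ('i%C *: a) = - ('i%C *: star a).
Proof. by rewrite starZ complexiE conjCi scaleNr. Qed.

(** If u, b are commuting self-adjoint elements with u^2 + b^2 = t, then
w = u + i b satisfies star w * w = t, and b is a combination of w and star w. *)
Lemma sum_squares_bound u b t : 0 <= t -> star u = u -> star b = b -> u * b = b * u ->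
  u * u + b * b = t%:C *: 1 -> rnorm b ^+ 2 <= t.
Proof.
move=> t0 su sb ub H; pose w := u + 'i%C *: b.
have sw : star w = u - 'i%C *: b by rewrite starD star_ii su sb.
have ww : star w * w = t%:C *: 1.
  rewrite sw /w mulrDr !mulrBl -!scalerAr -!scalerAl ub scalerA.
  rewrite mul_ii scaleN1r opprK -H.
  by rewrite addrA subrK.
have wt : rnorm w ^+ 2 = t by rewrite -rnorm_cstar ww rnorm_sc ger0_norm.
have bE : b = - ('i%C *: ((2^-1 : R)%:C *: (w - star w))).
  rewrite sw /w opprB addrC addrA subrK scaleC_half scalerA.
  by rewrite mul_ii scaleN1r opprK.
rewrite -wt bE rnormN rnormZ rnorm_ii mul1r rnormZR ger0_norm ?invr_ge0//.
rewrite ler_pXn2r ?nnegrE ?mulr_ge0 ?invr_ge0 ?rnorm_ge0//.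
have := ler_rnormD w (- star w); rewrite rnormN rnorm_star; lra.
Qed.

(** [sum_squares_bound] applied to b = sqrt (t - u^2). *)
Lemma square_bound u t : 0 < t -> star u = u -> rnorm u ^+ 2 <= t ->
  rnorm (t%:C *: 1 - u * u) <= t.
Proof.
move=> t0 su ut.
have suu : star (u * u) = u * u by rewrite star_mulE su.
have [|b [[sb _] bb cb]] := sqrt_sc_sub t0 suu; first by rewrite rnorm_sa.
rewrite -bb rnorm_sa//; apply: (@sum_squares_bound u b) => //; first exact: ltW.
  by rewrite cb// mulrA.
by rewrite bb addrC subrK.
Qed.

Lemma psd_sq u : star u = u -> psd (u * u).
Proof.
move=> su; split; first by rewrite star_mulE su.
exists (rnorm u ^+ 2 + 1); first by rewrite addr_ge0// sqr_ge0.
by apply: square_bound => //; rewrite ?lerDl// ltr_wpDl// sqr_ge0.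
Qed.

(** A positive element satisfies the defining bound for every t >= |a|, not just
for some t; this uniformity is what makes the cone closed. *)
Lemma psd_norm_bound a t : psd a -> rnorm a <= t -> rnorm (t%:C *: 1 - a) <= t.
Proof.
move=> pa at_; have [b [[sb _] bb _]] := psd_sqrt pa.
have [a0|a0] := eqVneq (rnorm a) 0.
  rewrite (rnorm_eq0 a0) subr0 rnorm_sc ger0_norm//.
  by apply: le_trans at_; exact: rnorm_ge0.
rewrite -bb; apply: square_bound => //; last by rewrite -rnorm_sa// bb.
by apply: lt_le_trans at_; rewrite lt_neqAle eq_sym a0 rnorm_ge0.
Qed.

(** The norm is monotone on positive elements. *)
Lemma psd_le_norm p q : psd p -> psd (q - p) -> rnorm p <= rnorm q.
Proof.
move=> pp pqp.
have pq : psd q by rewrite -(subrK p q); exact: psdD.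
have tq : psd ((rnorm q)%:C *: 1 - q) by apply: psd_sc_sub => //; case: pq.
have tp : psd ((rnorm q)%:C *: 1 - p) by rewrite -(subrK q (_ *: _)) -addrA; exact: psdD.
have [b [[sb _] bb cb]] := psd_sqrt pp.
have [e [[se _] ee ce]] := psd_sqrt tp.
rewrite -bb rnorm_sa//; apply: (@sum_squares_bound e b) => //; first exact: rnorm_ge0.
  apply: ce; rewrite mulrBl mulrBr -scalerAl -scalerAr mul1r mulr1; congr (_ - _).
  by rewrite -bb mulrA.
by rewrite ee bb subrK.
Qed.

Lemma psd_antisym a : psd a -> psd (- a) -> a = 0.
Proof.
move=> pa na; apply: rnorm_eq0; apply/eqP; rewrite eq_le rnorm_ge0 andbT -(rnorm0 A).
by apply: psd_le_norm; rewrite // sub0r.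
Qed.

Lemma psd_closed (f : nat -> A) a : (f @ \oo --> a) -> (forall n, psd (f n)) -> psd a.
Proof.
move=> fa pf; split.
  apply: (cvgn_uniq (cvgn_star fa)); rewrite (_ : (fun n => _) = f)//.
  by apply/funext => n; case: (pf n).
have [N HN] := cvgn_bounded fa.
exists (rnorm a + 1); first by rewrite addr_ge0// rnorm_ge0.
apply: (@cvgn_rnorm_le _ _ (fun n => (rnorm a + 1)%:C *: 1 - f n) _ _ N).
  by apply: cvgB => //; exact: cvg_cst.
by move=> n /HN; exact: psd_norm_bound.
Qed.

End Psd.

(** * Positivity of star c * c *)

Section Kaplansky.
Variables (R : realType) (A : cstarAlgType R).
Implicit Types (a b c p q u x z : A) (s t : R).

Lemma psd_half a : psd (a + a) -> psd a.
Proof.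
by move=> H; rewrite -(scaleC_half a); apply: psdZ => //; rewrite invr_ge0.
Qed.

(** With u = x + star x and v = i (x - star x), both self-adjoint,
u^2 + v^2 is twice the sum. *)
Lemma psd_cstarD x : psd (x * star x + star x * x).
Proof.
apply: psd_half.
pose u := x + star x; pose v := 'i%C *: (x - star x).
have su : star u = u by rewrite starD star_starE addrC.
have sv : star v = v by rewrite star_ii starB star_starE -scalerN opprB.
have -> : x * star x + star x * x + (x * star x + star x * x) = u * u + v * v.
  rewrite /v -scalerAl -scalerAr scalerA mul_ii scaleN1r /u.
  rewrite !mulrDl !mulrDr !mulNr !mulrN opprK !opprD !opprK.
  rewrite [RHS]addrACA [X in _ = X + _]addrACA [X in _ = _ + X]addrACA !subrr add0r addr0.
  by rewrite addrACA.
by apply: psdD; exact: psd_sq.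
Qed.

(** Let a = - star x * x be positive. Then star x * (t - x * star x) * x is
-(t a + a^2), and its norm is at most t |x|^2 = t |a| for suitable t. Completing
the square, (|a| + t / 2)^2 <= t |a| + t^2 / 4, which forces a = 0. *)
Lemma cstar_npsd x : psd (- (star x * x)) -> x = 0.
Proof.
move=> pa; set a := - (star x * x) in pa.
have [sx [t t0 tx]] : psd (x * star x).
  by rewrite -(addrK (star x * x) (x * star x)); exact: psdD (psd_cstarD _) pa.
pose s := rnorm a.
have sE : s = rnorm x ^+ 2 by rewrite /s rnormN rnorm_cstar.
have s0 : 0 <= s by exact: rnorm_ge0.
have H1 : rnorm (t%:C *: a + a * a) <= t * s.
  have -> : t%:C *: a + a * a = - (star x * (t%:C *: 1 - x * star x) * x).
    rewrite mulrBr mulrBl opprB -scalerAr mulr1 -scalerAl /a mulrNN scalerN addrC.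
    by rewrite !mulrA.
  rewrite rnormN; apply: le_trans (rnormM _ _) _.
  apply: le_trans (ler_wpM2r (rnorm_ge0 _) (rnormM _ _)) _.
  rewrite rnorm_star sE expr2 mulrA ler_wpM2r ?rnorm_ge0// mulrC.
  by rewrite ler_wpM2r ?rnorm_ge0.
(* m^2 = t a + a^2 + t^2 / 4 *)
pose m := a + (t / 2)%:C *: 1.
have pm : psd m by apply: psdD => //; apply: psd_sc; lra.
have [sm _] := pm.
have mm : m * m = t%:C *: a + a * a + (t ^+ 2 / 4)%:C *: 1.
  set r := t ^+ 2 / 4; rewrite mulrDl !mulrDr -!scalerAl -!scalerAr !mul1r mulr1 scalerA.
  rewrite addrA -rmorphM /=.
  congr (_ + _ *: _); last by congr (_%:C); rewrite /r; field.
  by rewrite -addrA -scalerDl -rmorphD /= -splitr addrC.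
have nm : rnorm m ^+ 2 <= t * s + t ^+ 2 / 4.
  rewrite -rnorm_sa// mm; apply: le_trans (ler_rnormD _ _) _.
  by apply: lerD => //; rewrite rnorm_sc ger0_norm// divr_ge0// sqr_ge0.
have tm : t / 2 <= rnorm m.
  have <- : rnorm ((t / 2)%:C *: (1 : A)) = t / 2 by rewrite rnorm_sc ger0_norm//; lra.
  by apply: psd_le_norm; [apply: psd_sc; lra | rewrite addrK].
have sm2 : s <= rnorm m - t / 2.
  have <- : rnorm ((rnorm m - t / 2)%:C *: (1 : A)) = rnorm m - t / 2.
    by rewrite rnorm_sc ger0_norm// subr_ge0.
  apply: psd_le_norm => //; rewrite scB -addrA -opprD [_ + a]addrC.
  by apply: psd_sc_sub.
have : s ^+ 2 <= 0 by nra.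
rewrite sE => h; apply: rnorm_eq0; apply/eqP.
by rewrite -sqrf_eq0 -sqrf_eq0 eq_le h sqr_ge0.
Qed.

(** Kaplansky's theorem. Put h = star c * c, k = sqrt (h^2) and g = k - h. Then
star (c g) * (c g) = g h g = - g k g is negative, hence zero, so that
g^3 = 2 k g^2 = 0 and h = k. *)
Lemma psd_cstar c : psd (star c * c).
Proof.
set h := star c * c.
have sh : star h = h by rewrite star_mulE star_starE.
have [k [pk kk ck]] := psd_sqrt (psd_sq sh).
have [m [[sm _] mm cm]] := psd_sqrt pk.
have [sk _] := pk.
have kh : k * h = h * k by apply: ck; rewrite mulrA.
pose g := k - h.
have sg : star g = g by rewrite starB sk sh.
have kg : k * g = g * k by rewrite mulrBr mulrBl kh.
have mg : m * g = g * m by exact: cm.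
have hg : h * g = - (k * g) by rewrite !mulrBr opprB kh kk.
have gg : g * g = k * g + k * g by rewrite {1}/g mulrBl hg opprK.
have xE : star (c * g) * (c * g) = - (g * k * g).
  by rewrite star_mulE sg mulrA -(mulrA g) -/h -mulrA hg mulrN mulrA.
have gkg : psd (g * k * g).
  have -> : g * k * g = (m * g) * (m * g) by rewrite -mm !mulrA mg.
  by apply: psd_sq; rewrite star_mulE sg sm mg.
have g0 : g * k * g = 0.
  have x0 : c * g = 0 by apply: cstar_npsd; rewrite xE opprK.
  by apply: oppr_inj; rewrite -xE x0 mulr0 oppr0.
have g3 : g * g * g = 0 by rewrite gg mulrDl kg g0 addr0.
have gz : g = 0.
  apply: rnorm_eq0; apply/eqP; rewrite -sqrf_eq0 -sqrf_eq0.
  by rewrite -rnorm_sa// -rnorm_sa ?star_mulE ?sg// mulrA g3 mul0r rnorm0.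
by rewrite -[h](subKr k) -/g gz subr0.
Qed.

(** The order of the C*-algebra is the one given by [psd]. *)
Lemma cposP a : cpos a <-> psd a.
Proof.
split=> [[c ->]|/psd_sqrt[b [[sb _] bb _]]]; first exact: psd_cstar.
by exists b; rewrite sb bb.
Qed.

Lemma psd_conj c a : psd a -> psd (star c * a * c).
Proof.
move=> /psd_sqrt[b [[sb _] <- _]].
by rewrite mulrA -{1}sb -star_mulE -mulrA; exact: psd_cstar.
Qed.

End Kaplansky.

(** * The Hahn-Banach theorem *)

Section HahnBanach.
Variables (R : realType) (V : lmodType R[i]).
Implicit Types (p q : V -> R) (x y a : V) (s t : R).

(** Sublinear functionals on a complex vector space seen as a real one. Positive
homogeneity is stated as an inequality, from which equality follows
([sublinear_pos]). *)
Definition sublinear q : Prop :=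
  (forall x y, q (x + y) <= q x + q y) /\
  (forall t x, 0 < t -> q (t%:C *: x) <= t * q x).

Lemma le_inf_add (S1 S2 : set R) (c : R) : S1 !=set0 -> S2 !=set0 ->
  (forall s t, S1 s -> S2 t -> c <= s + t) -> c <= inf S1 + inf S2.
Proof.
move=> S10 S20 H; rewrite -lerBlDr; apply: lb_le_inf => // s S1s.
rewrite lerBlDr addrC -lerBlDr; apply: lb_le_inf => // t S2t.
by rewrite lerBlDr addrC; exact: H.
Qed.

Lemma scale_real_invK t x : t != 0 -> (t^-1)%:C *: (t%:C *: x) = x.
Proof. by move=> t0; rewrite scalerA -rmorphM /= mulVf// scale1r. Qed.

Lemma sublinear0_ge0 q : sublinear q -> 0 <= q 0.
Proof. by move=> [qD _]; have := qD 0 0; rewrite addr0; lra. Qed.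

Lemma sublinear_oppr q x : sublinear q -> - q (- x) <= q x.
Proof.
by move=> sq; have := sublinear0_ge0 sq; have := sq.1 x (- x); rewrite subrr; lra.
Qed.

Lemma sublinear_pos q t x : sublinear q -> 0 < t -> q (t%:C *: x) = t * q x.
Proof.
move=> sq t0; apply/eqP; rewrite eq_le sq.2//=.
have := sq.2 t^-1 (t%:C *: x); rewrite invr_gt0 => /(_ t0).
by rewrite scale_real_invK ?gt_eqF// mulrC ler_pdivlMr// mulrC.
Qed.

(** The sublinear functional below q that is additive in the direction a:
x |-> inf_(t >= 0) (q (x + t a) - t q a). *)
Definition sub_red q a x : R :=
  inf [set q (x + t%:C *: a) - t * q a | t in [set t | 0 <= t]].

Section SubRed.
Variables (q : V -> R) (a : V) (sq : sublinear q).

Let S x := [set q (x + t%:C *: a) - t * q a | t in [set t : R | 0 <= t]].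

Lemma sub_red_nonempty x : S x !=set0.
Proof. by exists (q (x + (0 : R)%:C *: a) - 0 * q a); exists 0 => /=. Qed.

Lemma sub_red_lb x : lbound (S x) (- q (- x)).
Proof.
move=> _ [t /= t0 <-].
have H : t * q a <= q (t%:C *: a).
  have [->|tn0] := eqVneq t 0; first by rewrite mul0r scale0r sublinear0_ge0.
  by rewrite sublinear_pos// lt_neqAle eq_sym tn0.
have := sq.1 (x + t%:C *: a) (- x).
by rewrite addrAC subrr add0r; lra.
Qed.

Lemma sub_red_le x t : 0 <= t -> sub_red q a x <= q (x + t%:C *: a) - t * q a.
Proof.
move=> t0; apply: ge_inf; first by exists (- q (- x)); exact: sub_red_lb.
by exists t.
Qed.

Lemma sub_red_le0 x : sub_red q a x <= q x.
Proof. by have := sub_red_le x (lexx 0); rewrite scale0r addr0 mul0r subr0. Qed.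

Lemma sub_red_sublinear : sublinear (sub_red q a).
Proof.
split=> [x y|r x r0].
  apply: le_inf_add; [exact: sub_red_nonempty|exact: sub_red_nonempty|].
  move=> _ _ [s /= s0 <-] [t /= t0 <-].
  apply: le_trans (sub_red_le _ (addr_ge0 s0 t0)) _.
  rewrite rmorphD scalerDl addrACA.
  by have := sq.1 (x + s%:C *: a) (y + t%:C *: a); rewrite /=; lra.
rewrite mulrC -ler_pdivrMr//; apply: lb_le_inf; first exact: sub_red_nonempty.
move=> _ [t /= t0 <-]; rewrite ler_pdivrMr//.
apply: le_trans (sub_red_le _ (mulr_ge0 (ltW r0) t0)) _.
rewrite rmorphM -scalerA -scalerDr sublinear_pos//.
by rewrite le_eqVlt; apply/orP; left; apply/eqP; ring.
Qed.

End SubRed.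

(** A minimal sublinear functional is linear, since it equals all its reductions
[sub_red]; minimal ones exist below p by Zorn's lemma. *)
Lemma sublinear_zorn p : sublinear p -> exists f : V -> R,
  [/\ forall x y, f (x + y) = f x + f y, forall t x, f (t%:C *: x) = t * f x &
      forall x, f x <= p x].
Proof.
move=> sp; pose T := {q : V -> R | sublinear q /\ forall x, q x <= p x}.
pose le (s t : T) : bool := `[< forall x, sval t x <= sval s x >].
have [||||[q [sq qp]] qmin] := @Zorn T le.
- by move=> t; apply/asboolP => x.
- move=> r s t /asboolP rs /asboolP st; apply/asboolP => x.
  exact: le_trans (st x) (rs x).
- move=> [s Hs] [t Ht] /asboolP /= st /asboolP /= ts; apply: eq_exist.
  by apply/funext => x; apply/eqP; rewrite eq_le st ts.
- move=> C Ctot.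
  have [[t0 Ct0]|C0] := pselect (C !=set0); last first.
    by exists (exist _ p (conj sp (fun x => lexx _))) => s Cs; case: C0; exists s.
  pose S x := [set sval t x | t in C].
  have S0 x : S x !=set0 by exists (sval t0 x), t0.
  have Slb x : lbound (S x) (- p (- x)).
    move=> _ [[t [st tp]] Ct <-] /=.
    by apply: le_trans (sublinear_oppr x st); rewrite lerN2.
  pose m x := inf (S x).
  have m_le x (t : T) : C t -> m x <= sval t x.
    by move=> Ct; apply: ge_inf; [exists (- p (- x)); exact: Slb | exists t].
  have sm : sublinear m.
    split=> [x y|r x r0].
      apply: (le_inf_add (S0 x) (S0 y)) => _ _ [s Cs <-] [t Ct <-].
      have [/asboolP st|/asboolP ts] := Ctot _ _ Cs Ct.
        apply: le_trans (m_le _ _ Ct) _; apply: le_trans ((svalP t).1.1 x y) _.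
        by rewrite lerD2r.
      apply: le_trans (m_le _ _ Cs) _; apply: le_trans ((svalP s).1.1 x y) _.
      by rewrite lerD2l.
    rewrite mulrC -ler_pdivrMr//; apply: lb_le_inf; [exact: S0 | move=> _ [t Ct <-]].
    rewrite ler_pdivrMr// mulrC; apply: le_trans (m_le _ _ Ct) _.
    exact: (svalP t).1.2.
  have mp x : m x <= p x by apply: le_trans (m_le _ _ Ct0) _; exact: (svalP t0).2.
  exists (exist _ m (conj sm mp)) => s Cs; apply/asboolP => x /=; exact: m_le.
have qD x a : q (x + a) = q x + q a.
  apply/eqP; rewrite eq_le sq.1 /=.
  have H : sublinear (sub_red q a) /\ forall x, sub_red q a x <= p x.
    split; first exact: sub_red_sublinear.
    by move=> z; apply: le_trans (sub_red_le0 _ sq z) _.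
  have E : sub_red q a = q.
    suff /qmin/(congr1 sval) : le (exist _ q (conj sq qp)) (exist _ (sub_red q a) H) by [].
    by apply/asboolP => z /=; exact: sub_red_le0.
  have := sub_red_le a sq x ler01; rewrite E scale1r mul1r; lra.
have q0 : q 0 = 0 by have := qD 0 0; rewrite addr0; lra.
exists q; split => // t x.
have qN y : q (- y) = - q y by have := qD y (- y); rewrite subrr q0; lra.
case: (ltgtP t 0) => [t0|t0|->].
- rewrite -[t]opprK rmorphN scaleNr qN sublinear_pos ?oppr_gt0//; lra.
- exact: sublinear_pos.
- by rewrite scale0r mul0r.
Qed.

(** A real-linear functional dominated by p and tangent to it at h: apply
[sublinear_zorn] to the reduction of p in the direction h. *)
Lemma hahn_banach p h : sublinear p -> exists f : V -> R,
  [/\ forall x y, f (x + y) = f x + f y, forall t x, f (t%:C *: x) = t * f x,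
      forall x, f x <= p x & p h <= f h].
Proof.
move=> sp; have [f [fD fZ fp]] := sublinear_zorn (sub_red_sublinear h sp).
have f0 : f 0 = 0 by have := fD 0 0; rewrite addr0; lra.
exists f; split => //.
  by move=> x; apply: le_trans (fp x) _; exact: sub_red_le0.
have p0 : p 0 = 0.
  by have := sublinear_pos 0 sp (ltr0Sn R 1); rewrite scaler0; lra.
have := le_trans (fp (- h)) (sub_red_le h sp (- h) ler01).
rewrite scale1r addNr p0 mul1r add0r.
by have := fD h (- h); rewrite subrr f0; lra.
Qed.

End HahnBanach.

(** * States *)

Section StateProps.
Variables (R : realType) (A : cstarAlgType R) (phi : {scalar A}).
Hypothesis sphi : is_state phi.
Implicit Types (a b c : A).

Lemma state_ge0 a : psd a -> 0 <= phi a.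
Proof. by move=> /cposP; exact: sphi.1. Qed.

Lemma state_le1 a : rnorm a <= 1 -> rnorm (phi a) <= 1.
Proof.
move=> a1; rewrite -lee_fin -sphi.2; apply: ereal_sup_ubound.
by exists a.
Qed.

Lemma scalarZ (r : R[i]) a : phi (r *: a) = r * phi a.
Proof. by rewrite linearZ. Qed.

Lemma rnormcM (y z : R[i]) : rnorm (y * z) = rnorm y * rnorm z.
Proof. by apply: complexI; rewrite rmorphM /= -!normcE_rnorm normrM. Qed.

Lemma state_norm a : rnorm (phi a) <= rnorm a.
Proof.
have [->|a0] := eqVneq a 0; first by rewrite linear0 rnorm0 rnorm_ge0.
have ra : 0 < rnorm a.
  by rewrite lt_neqAle rnorm_ge0 eq_sym andbT; apply: contraNneq a0 => /rnorm_eq0->.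
have := @state_le1 ((rnorm a)^-1%:C *: a).
rewrite scalarZ rnormZR ger0_norm ?invr_ge0 ?rnorm_ge0// mulVf ?gt_eqF//.
move=> /(_ (lexx _)); rewrite rnormcM rnormR.
by rewrite ger0_norm ?invr_ge0 ?rnorm_ge0// mulrC ler_pdivrMr// mul1r.
Qed.

Lemma psd_diff a : star a = a -> exists p q, [/\ psd p, psd q & a = p - q].
Proof.
move=> sa; exists ((rnorm a)%:C *: 1), ((rnorm a)%:C *: 1 - a); split.
- by apply: psd_sc; exact: rnorm_ge0.
- exact: psd_sc_sub.
- by rewrite subKr.
Qed.

Lemma state_real a : star a = a -> complex.Im (phi a) = 0.
Proof.
move=> /psd_diff[p [q [/state_ge0 + /state_ge0 + ->]]].
rewrite linearB; case: (phi p) => x y; case: (phi q) => z t.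
by rewrite !lecE /= => /andP[/eqP-> _] /andP[/eqP-> _]; rewrite subr0.
Qed.

Lemma state_star a : phi (star a) = Num.conj (phi a).
Proof.
have h1 : complex.Im (phi (a + star a)) = 0.
  by apply: state_real; rewrite starD star_starE addrC.
have h2 : complex.Im (phi ('i%C *: (a - star a))) = 0.
  by apply: state_real; rewrite star_ii starB star_starE -scalerN opprB.
move: h1 h2; rewrite scalarZ linearB linearD.
rewrite -[Num.conj _]/(conjc _).
case: (phi a) => x y; case: (phi (star a)) => z t /= h1 h2.
by apply/eqP; rewrite eq_complex /=; apply/andP; split; apply/eqP; lra.
Qed.

Lemma rnormcE (z : R[i]) : rnorm z ^+ 2 = complex.Re z ^+ 2 + complex.Im z ^+ 2.
Proof. by rewrite /rnorm normc_def /= sqr_sqrtr// addr_ge0// sqr_ge0. Qed.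

(** Expand phi (star d * d) >= 0 for d = star c - conj (phi c), using phi 1 <= 1. *)
Lemma state_cauchy_schwarz c : rnorm (phi c) ^+ 2 <= complex.Re (phi (c * star c)).
Proof.
pose l : R[i] := phi c.
have := state_ge0 (psd_cstar (star c - Num.conj l *: 1)).
rewrite starB star_starE starZ star1 conjCK mulrBl !mulrBr -!scalerAl -!scalerAr mulr1 !mul1r.
rewrite scalerA !linearB !scalarZ state_star -/l.
have := state_le1 (a := 1); rewrite rnorm1 => /(_ (lexx _)).
have := state_ge0 (psd_sc A (@ler01 R)); rewrite scale1r.
rewrite rnormcE -[Num.conj l]/(conjc l) -/l.
move: (phi (c * star c)) (phi 1) l => [x y] [z t] [u v] /=.
rewrite !lecE /= => /andP[/eqP-> z0].
rewrite /rnorm normc_def /= expr0n addr0 sqrtr_sqr ger0_norm// => z1 /andP[_].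
have : 0 <= u ^+ 2 + v ^+ 2 by rewrite addr_ge0 ?sqr_ge0.
nra.
Qed.

End StateProps.

Section StateExistence.
Variables (R : realType) (A : cstarAlgType R).
Implicit Types (a b c : A) (t : R).

Lemma psd_sc_ge0 t : psd (t%:C *: (1 : A)) -> 0 <= t.
Proof.
move=> pt; rewrite leNgt; apply/negP => t0.
have := psd_antisym pt; rewrite -scaleNr -rmorphN => /(_ (psd_sc A _)).
rewrite oppr_ge0 (ltW t0) => /(_ isT) h.
by have := rnorm_sc A t; rewrite h rnorm0 => /esym/eqP; rewrite normr_eq0 lt_eqF.
Qed.

(** The infimum of the real t with a + star a <= t. *)
Definition top_re a : R := inf [set t : R | psd (t%:C *: 1 - (a + star a))].

Lemma star_selfD a : star (a + star a) = a + star a.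
Proof. by rewrite starD star_starE addrC. Qed.

Lemma top_re_ne a : [set t : R | psd (t%:C *: 1 - (a + star a))] !=set0.
Proof. by exists (rnorm (a + star a)) => /=; apply: psd_sc_sub => //; exact: star_selfD. Qed.

Lemma top_re_lb a : lbound [set t : R | psd (t%:C *: 1 - (a + star a))] (- rnorm (a + star a)).
Proof.
move=> t /= pt; rewrite -subr_ge0 opprK; apply: psd_sc_ge0.
have h : psd ((rnorm (a + star a))%:C *: 1 - - (a + star a)).
  by apply: psd_sc_sub; rewrite ?rnormN// starN star_selfD.
by have := psdD pt h; rewrite opprK addrACA addNr addr0 scD.
Qed.

Lemma top_re_le a t : psd (t%:C *: 1 - (a + star a)) -> top_re a <= t.
Proof. by move=> H; apply: ge_inf => //; eexists; exact: top_re_lb. Qed.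

Lemma le_top_re a t : (forall s : R, psd (s%:C *: 1 - (a + star a)) -> t <= s) -> t <= top_re a.
Proof. by move=> H; apply: lb_le_inf; [exact: top_re_ne | exact: H]. Qed.

Lemma top_re_sublinear : sublinear top_re.
Proof.
split=> [a b|r a r0].
  apply: le_inf_add; [exact: top_re_ne|exact: top_re_ne|].
  move=> s t /= ps pt; apply: top_re_le.
  by rewrite scD starD addrACA opprD addrACA; exact: psdD.
rewrite mulrC -ler_pdivrMr//; apply: le_top_re => s ps; rewrite ler_pdivrMr//.
apply: top_re_le; rewrite mulrC starZR -scalerDr rmorphM -scalerA -scalerBr.
by apply: psdZ => //; exact: ltW.
Qed.

(** A positive element has a state taking the value of its norm. The real-linear
functional f obtained from [top_re] vanishes on skew-adjoint elements, and the
state is a |-> (f a - i f (i a)) / 2; the factor 2 comes from a + star a being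
twice the real part of a. *)
Lemma exists_state a : psd a -> exists phi : {scalar A},
  is_state phi /\ phi a = (rnorm a)%:C.
Proof.
move=> pa; have [sa _] := pa.
have [f [fD fZ fp fa]] := hahn_banach a top_re_sublinear.
have f0 : f 0 = 0 by have := fD 0 0; rewrite addr0; lra.
have fN x : f (- x) = - f x by have := fD x (- x); rewrite subrr f0; lra.
have f_psd x : psd x -> 0 <= f x.
  move=> px; have [sx _] := px; have := fp (- x); rewrite fN.
  have : top_re (- x) <= 0.
    apply: top_re_le; rewrite scale0r sub0r starN sx opprD !opprK; exact: psdD.
  lra.
have f_sk x : star x = - x -> f x = 0.
  have H y : star y = - y -> f y <= 0.
    move=> sy; apply: le_trans (fp y) _; apply: top_re_le.
    by rewrite sy subrr scale0r subr0; exact: psd0.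
  move=> sx; have := H x sx; have := H (- x); rewrite starN sx fN => /(_ erefl); lra.
have f1 : f 1 = 2.
  have : f 1 <= 2.
    apply: le_trans (fp _) _; apply: top_re_le.
    rewrite star1 (_ : 2%:C *: _ = 1 + 1 :> A) ?subrr; first exact: psd0.
    by rewrite rmorphD scalerDl scale1r.
  have : f (- 1) <= -2.
    apply: le_trans (fp _) _; apply: top_re_le.
    rewrite starN star1 (_ : (-2)%:C *: _ = - 1 - 1 :> A) ?subrr; first exact: psd0.
    by rewrite rmorphN rmorphD scaleNr scalerDl scale1r opprD.
  rewrite fN; lra.
have fle x : f x <= 2 * rnorm x.
  apply: le_trans (fp x) _; apply: le_trans (_ : rnorm (x + star x) <= _).
    by apply: top_re_le; apply: psd_sc_sub => //; exact: star_selfD.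
  by apply: le_trans (ler_rnormD _ _) _; rewrite rnorm_star; lra.
have fa2 : f a = 2 * rnorm a.
  apply/eqP; rewrite eq_le fle /=; apply: le_trans fa; apply: le_top_re => s ps.
  have paa : psd (a + a) by exact: psdD.
  have pq : psd (s%:C *: 1 - (a + a)) by rewrite -{2}sa.
  have s0 : 0 <= s by apply: psd_sc_ge0; rewrite -(subrK (a + a) (_ *: _)); exact: psdD.
  have := psd_le_norm paa pq; rewrite rnorm_sc ger0_norm//.
  have <- : rnorm (2%:C *: a) = 2 * rnorm a by rewrite rnormZR ger0_norm.
  by rewrite rmorphD scalerDl scale1r.
pose phi0 (x : A) : R[i] := (f x / 2) +i* (- f ('i%C *: x) / 2).
have phi_lin : scalar phi0.
  move=> [u v] x y; rewrite /phi0.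
  have cE z : (u +i* v)%C *: z = u%:C *: z + v%:C *: ('i%C *: z).
    rewrite scalerA -scalerDl; congr (_ *: _).
    by apply/eqP; rewrite eq_complex /=; apply/andP; split; apply/eqP; ring.
  have E1 : f ((u +i* v)%C *: x + y) = u * f x + v * f ('i%C *: x) + f y.
    by rewrite fD cE fD !fZ.
  have E2 : f ('i%C *: ((u +i* v)%C *: x + y)) = u * f ('i%C *: x) - v * f x + f ('i%C *: y).
    rewrite scalerDr fD scalerA mulrC -scalerA cE fD !fZ scalerA mul_ii scaleN1r fN.
    by rewrite mulrN.
  by rewrite E1 E2; apply/eqP; rewrite eq_complex /=; apply/andP; split; apply/eqP; field.
pose phi_mix := GRing.isLinear.Build _ _ _ _ phi0 phi_lin.
pose phi : {scalar A} := HB.pack phi0 phi_mix.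
have phiE x : phi x = (f x / 2) +i* (- f ('i%C *: x) / 2) by [].
have phi_sa x : star x = x -> phi x = (f x / 2)%:C.
  move=> sx; rewrite phiE (f_sk ('i%C *: x)) ?oppr0 ?mul0r//.
  by rewrite star_ii sx.
exists phi; split; last by rewrite phi_sa// fa2; congr (_%:C); field.
have phi_norm x : rnorm (phi x) <= rnorm x.
  have [->|p0] := eqVneq (rnorm (phi x)) 0; first by rewrite rnorm_ge0.
  (* Rotate x so that phi takes a real value at it, where phi is f / 2. *)
  pose u : R[i] := (rnorm (phi x))%:C / phi x.
  have pn0 : phi x != 0 by apply: contra_neq p0 => ->; rewrite rnorm0.
  have up : phi (u *: x) = (rnorm (phi x))%:C.
    by rewrite scalarZ /u -mulrA mulVf// mulr1.
  have u1 : rnorm u = 1.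
    apply: complexI; rewrite -normcE_rnorm /u normrM normfV -normcE_rnorm normr_id mulfV//.
    by rewrite normr_eq0.
  have : complex.Re (phi (u *: x)) <= rnorm (u *: x).
    by rewrite phiE /=; have := fle (u *: x); lra.
  by rewrite up /= rnormZ u1 mul1r.
split.
  move=> b /cposP pb; have [sb _] := pb.
  by rewrite phi_sa// ler0c; have := f_psd _ pb; lra.
apply/eqP; rewrite eq_le; apply/andP; split.
  apply: ge_ereal_sup => _ [x /= x1 <-]; rewrite lee_fin.
  exact: le_trans (phi_norm x) _.
apply: ereal_sup_ubound; exists 1; first by rewrite /= rnorm1.
by rewrite phi_sa ?star1// f1 divff// rnormR normr1.
Qed.

End StateExistence.

(** * The standard Hilbert module *)

Section FiniteCS.
Variables (R : realType) (A : cstarAlgType R) (I : Type) (r : seq I).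
Implicit Types (x y : I -> A) (t : R).

Lemma psd_gram x : psd (\sum_(i <- r) star (x i) * x i).
Proof. by apply: psd_sum => i _; exact: psd_cstar. Qed.

Lemma star_sum (F : I -> A) : star (\sum_(i <- r) F i) = \sum_(i <- r) star (F i).
Proof. by apply: (big_morph (@star R A)); [exact: starD | exact: star0]. Qed.

(** Operator form of the Cauchy-Schwarz inequality. With s = <x, y>, it is the
positivity of <x s - t y, x s - t y> + star s * (t - <x, x>) * s, divided by t. *)
Lemma gram_cauchy_schwarz_psd x y t : 0 < t ->
  psd (t%:C *: 1 - \sum_(i <- r) star (x i) * x i) ->
  psd (t%:C *: (\sum_(i <- r) star (y i) * y i)
       - star (\sum_(i <- r) star (x i) * y i) * (\sum_(i <- r) star (x i) * y i)).
Proof.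
move=> t0; set X := \sum_(i <- r) star (x i) * x i.
set Y := \sum_(i <- r) star (y i) * y i; set s := \sum_(i <- r) star (x i) * y i.
move=> /(psd_conj s) H1.
have H2 := psd_gram (fun i => x i * s - t%:C *: y i).
have E : \sum_(i <- r) star (x i * s - t%:C *: y i) * (x i * s - t%:C *: y i) =
  star s * X * s - t%:C *: (star s * s) - t%:C *: (star s * s) + t%:C *: (t%:C *: Y).
  have sE : star s = \sum_(i <- r) star (y i) * x i.
    by rewrite star_sum; apply: eq_bigr => i _; rewrite star_mulE star_starE.
  have e1 : t%:C *: (star s * s) = \sum_(i <- r) t%:C *: (star (y i) * x i * s).
    by rewrite -scaler_sumr; congr (_ *: _); rewrite sE mulr_suml.
  have e2 : t%:C *: (star s * s) = \sum_(i <- r) t%:C *: (star s * (star (x i) * y i)).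
    by rewrite -scaler_sumr; congr (_ *: _); rewrite -mulr_sumr.
  rewrite {1}e2 e1.
  rewrite /X /Y mulr_sumr mulr_suml !scaler_sumr -!sumrB -big_split /=.
  apply: eq_bigr => i _; rewrite starB star_mulE starZR mulrBl !mulrBr opprB.
  rewrite -!scalerAl -!scalerAr !mulrA.
  by rewrite addrA [RHS]addrAC.
have := psdD H2 H1; rewrite E mulrBr mulrBl -scalerAr mulr1 -scalerAl => H3.
have {}H3 : psd (t%:C *: (t%:C *: Y - star s * s)).
  rewrite scalerBr; move: H3; set a := star s * X * s; set b := t%:C *: (star s * s).
  set c := t%:C *: (_ *: _).
  by rewrite addrC !addrA subrK subrr sub0r addrC.
have := @psdZ _ _ t^-1 _ _ H3.
by rewrite scale_real_invK ?gt_eqF// invr_ge0; apply; exact: ltW.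
Qed.

Lemma le_eps_mul (a b c : R) : 0 <= c -> (forall e : R, 0 < e -> a <= (b + e) * c) -> a <= b * c.
Proof.
move=> c0 H; apply/ler_addgt0Pr => e e0.
have c1 : 0 < c + 1 by lra.
have := H (e / (c + 1)) (divr_gt0 e0 c1); rewrite mulrDl => h; apply: le_trans h _.
rewrite lerD2l mulrAC ler_pdivrMr//; nra.
Qed.

Lemma gram_cauchy_schwarz x y : rnorm (\sum_(i <- r) star (x i) * y i) ^+ 2 <=
  rnorm (\sum_(i <- r) star (x i) * x i) * rnorm (\sum_(i <- r) star (y i) * y i).
Proof.
apply: le_eps_mul => [|e e0]; first exact: rnorm_ge0.
set N := rnorm (\sum_(i <- r) star (x i) * x i).
have Ne : 0 < N + e by rewrite ltr_wpDl// rnorm_ge0.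
have H : psd ((N + e)%:C *: 1 - \sum_(i <- r) star (x i) * x i).
  by apply: psd_sc_sub; [case: (psd_gram x) | rewrite lerDl ltW].
rewrite -rnorm_cstar.
have := psd_le_norm (psd_cstar _) (gram_cauchy_schwarz_psd y Ne H).
by rewrite rnormZR (ger0_norm (ltW Ne)).
Qed.

End FiniteCS.

Section Module.
Variables (R : realType) (A : cstarAlgType R).
Implicit Types (x y z : nat -> A) (a : A) (t : R) (P Q : pred nat).

Local Notation gram x := (series (fun j => star (x j) * x j)).

Lemma cvgn_is_cauchy (f : nat -> A) : cvgn f -> forall e : R, 0 < e ->
  exists N, forall n m, (N <= n)%N -> (n <= m)%N -> rnorm (f m - f n) < e.
Proof.
move=> /cvgn_rnormP H e e0; have [|N HN] := H (e / 2); first exact: divr_gt0.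
exists N => n m Nn nm; apply: le_lt_trans (ler_rnormBD (limn f) _ _) _.
rewrite (splitr e); apply: ltrD; first exact: HN (leq_trans Nn nm).
by rewrite rnormB; exact: HN.
Qed.

Lemma psd_gram_sub x n m : (n <= m)%N -> psd (gram x m - gram x n).
Proof. by move=> nm; rewrite sub_series_geq//; exact: psd_gram. Qed.

(** The series defining [hinner] converges. *)
Lemma HA_cvg x y : HA x -> HA y -> cvgn (series (fun j => star (x j) * y j)).
Proof.
move=> hx hy; apply: cvgn_cauchy => e e0.
have [N1 H1] := cvgn_is_cauchy hx e0; have [N2 H2] := cvgn_is_cauchy hy e0.
exists (maxn N1 N2) => n m; rewrite geq_max => /andP[n1 n2] nm.
have := H1 n m n1 nm; have := H2 n m n2 nm.
rewrite !sub_series_geq//; have := gram_cauchy_schwarz (index_iota n m) x y.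
set u := rnorm _; set v := rnorm _; set w := rnorm _ => H ve we.
rewrite -(ltr_pXn2r (n := 2))// ?nnegrE ?rnorm_ge0 ?(ltW e0)//.
apply: le_lt_trans H _; rewrite expr2; apply: ltr_pM => //; exact: rnorm_ge0.
Qed.

Lemma hinner_cvg x y : HA x -> HA y ->
  series (fun j => star (x j) * y j) @ \oo --> hinner x y.
Proof. by move=> hx hy; exact: HA_cvg. Qed.

Lemma hinner_eq x y a : (series (fun j => star (x j) * y j) @ \oo --> a) -> hinner x y = a.
Proof. by move=> /(cvg_lim (@norm_hausdorff _ _)). Qed.

Lemma hinner_star x y : HA x -> HA y -> star (hinner x y) = hinner y x.
Proof.
move=> hx hy; apply/esym/hinner_eq.
rewrite (_ : series _ = fun n => star (series (fun j => star (x j) * y j) n)); last first.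
  apply/funext => n; rewrite /series /= star_sum; apply: eq_bigr => i _.
  by rewrite star_mulE star_starE.
by apply: cvgn_star; exact: hinner_cvg.
Qed.

Lemma hinner_cvgD x y z : HA x -> HA y -> HA z ->
  series (fun j => star (x j) * (y + z) j) @ \oo --> hinner x y + hinner x z.
Proof.
move=> hx hy hz.
rewrite (_ : series _ = fun n => series (fun j => star (x j) * y j) n +
  series (fun j => star (x j) * z j) n).
  by apply: cvgD; exact: hinner_cvg.
apply/funext => n; rewrite /series /= -big_split /=; apply: eq_bigr => i _.
by rewrite -mulrDr.
Qed.

Lemma HA0 : HA (0 : nat -> A).
Proof.
apply: (cvgP (0 : A)); rewrite (_ : series _ = fun=> 0); first exact: cvg_cst.
by apply/funext => n; rewrite /series /= big1// => i _; rewrite mulr0.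
Qed.

Lemma HA_add x y : HA x -> HA y -> HA (x + y).
Proof.
move=> hx hy; apply: (cvgP ((hinner x x + hinner x y) + (hinner y x + hinner y y))).
rewrite (_ : series _ = fun n => series (fun j => star (x j) * (x + y) j) n +
   series (fun j => star (y j) * (x + y) j) n).
  by apply: cvgD; exact: hinner_cvgD.
apply/funext => n; rewrite /series /= -big_split /=; apply: eq_bigr => i _.
by rewrite -mulrDl -starD.
Qed.

Lemma hinnerDr x y z : HA x -> HA y -> HA z -> hinner x (y + z) = hinner x y + hinner x z.
Proof. by move=> hx hy hz; apply: hinner_eq; exact: hinner_cvgD. Qed.

Lemma hinnerDl x y z : HA x -> HA y -> HA z -> hinner (x + y) z = hinner x z + hinner y z.
Proof.
move=> hx hy hz; rewrite -hinner_star ?hinnerDr ?starD ?hinner_star//.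
exact: HA_add.
Qed.

Lemma hinner_cvgZ x y a : HA x -> HA y ->
  series (fun j => star (x j) * rscale y a j) @ \oo --> hinner x y * a.
Proof.
move=> hx hy.
rewrite (_ : series _ = fun n => series (fun j => star (x j) * y j) n * a).
  by apply: cvgn_mul; [exact: hinner_cvg | exact: cvg_cst].
apply/funext => n; rewrite /series /= mulr_suml; apply: eq_bigr => i _.
by rewrite /rscale mulrA.
Qed.

Lemma HA_rscale x a : HA x -> HA (rscale x a).
Proof.
move=> hx; apply: (cvgP (star a * (hinner x x * a))).
rewrite (_ : series _ = fun n => star a * series (fun j => star (x j) * rscale x a j) n).
  by apply: cvgn_mul; [exact: cvg_cst | exact: hinner_cvgZ].
apply/funext => n; rewrite /series /= mulr_sumr; apply: eq_bigr => i _.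
by rewrite /rscale star_mulE !mulrA.
Qed.

Lemma hinnerZr x y a : HA x -> HA y -> hinner x (rscale y a) = hinner x y * a.
Proof. by move=> hx hy; apply: hinner_eq; exact: hinner_cvgZ. Qed.

Lemma hinnerZl x y a : HA x -> HA y -> hinner (rscale x a) y = star a * hinner x y.
Proof.
move=> hx hy; rewrite -hinner_star ?hinnerZr ?star_mulE ?hinner_star//.
exact: HA_rscale.
Qed.

Lemma rscaleN1 x : - x = rscale x (-1).
Proof. by apply/funext => j; rewrite /rscale mulrN mulr1. Qed.

Lemma HA_opp x : HA x -> HA (- x).
Proof. by rewrite rscaleN1; exact: HA_rscale. Qed.

Lemma HA_sub x y : HA x -> HA y -> HA (x - y).
Proof. by move=> hx hy; apply: HA_add => //; exact: HA_opp. Qed.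

Lemma hinnerNr x y : HA x -> HA y -> hinner x (- y) = - hinner x y.
Proof. by move=> hx hy; rewrite rscaleN1 hinnerZr// mulrN mulr1. Qed.

Lemma hinnerNl x y : HA x -> HA y -> hinner (- x) y = - hinner x y.
Proof. by move=> hx hy; rewrite rscaleN1 hinnerZl// starN star1 mulNr mul1r. Qed.

Lemma hinnerBl x y z : HA x -> HA y -> HA z -> hinner (x - y) z = hinner x z - hinner y z.
Proof. by move=> hx hy hz; rewrite hinnerDl ?hinnerNl//; exact: HA_opp. Qed.

(** Partial sums of <x, x> are below <x, x>. *)
Lemma psd_hinner_sub x n : HA x -> psd (hinner x x - gram x n).
Proof.
move=> hx; apply: (@psd_closed _ _ (fun m => gram x (m + n)%N - gram x n)).
  apply: cvgB; last exact: cvg_cst.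
  by rewrite (cvg_shiftn n (gram x)); exact: hinner_cvg.
by move=> m; apply: psd_gram_sub; rewrite leq_addl.
Qed.

Lemma psd_hinner x : HA x -> psd (hinner x x).
Proof.
by move=> hx; have := psd_hinner_sub 0 hx; rewrite /series /= big_geq// subr0.
Qed.

Lemma hinner_cauchy_schwarz_psd x y t : HA x -> HA y -> 0 < t -> psd (t%:C *: 1 - hinner x x) ->
  psd (t%:C *: hinner y y - star (hinner x y) * hinner x y).
Proof.
move=> hx hy t0 H; pose xy := series (fun j => star (x j) * y j).
apply: (@psd_closed _ _ (fun n => t%:C *: gram y n - star (xy n) * xy n)).
  apply: cvgB.
    by apply: cvgZ; [exact: cvg_cst | exact: hinner_cvg].
  by apply: cvgn_mul; [apply: cvgn_star|]; exact: hinner_cvg.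
move=> n; apply: gram_cauchy_schwarz_psd => //.
by rewrite -[X in X - _](subrK (hinner x x)) -addrA; apply: psdD => //; exact: psd_hinner_sub.
Qed.

Lemma hnorm_ge0 x : 0 <= hnorm x. Proof. exact: sqrtr_ge0. Qed.

Lemma hnorm_sqr x : hnorm x ^+ 2 = rnorm (hinner x x).
Proof. by rewrite sqr_sqrtr// rnorm_ge0. Qed.

Lemma hinner_cauchy_schwarz x y : HA x -> HA y -> rnorm (hinner x y) <= hnorm x * hnorm y.
Proof.
move=> hx hy; rewrite -(ler_pXn2r (n := 2)) ?nnegrE ?mulr_ge0 ?rnorm_ge0 ?hnorm_ge0//.
rewrite exprMn !hnorm_sqr; apply: le_eps_mul => [|e e0]; first exact: rnorm_ge0.
have Ne : 0 < rnorm (hinner x x) + e by rewrite ltr_wpDl// rnorm_ge0.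
have H : psd ((rnorm (hinner x x) + e)%:C *: 1 - hinner x x).
  by apply: psd_sc_sub; [case: (psd_hinner hx) | rewrite lerDl ltW].
rewrite -rnorm_cstar.
have := psd_le_norm (psd_cstar _) (hinner_cauchy_schwarz_psd hx hy Ne H).
by rewrite rnormZR (ger0_norm (ltW Ne)).
Qed.

Lemma hnorm_triangle x y : HA x -> HA y -> hnorm (x + y) <= hnorm x + hnorm y.
Proof.
move=> hx hy.
rewrite -(ler_pXn2r (n := 2)) ?nnegrE ?addr_ge0 ?hnorm_ge0//.
rewrite hnorm_sqr hinnerDl ?hinnerDr//; last exact: HA_add.
apply: le_trans (ler_rnormD _ _) _.
have h1 := ler_rnormD (hinner x x) (hinner x y).
have h2 := ler_rnormD (hinner y x) (hinner y y).
have h3 := hinner_cauchy_schwarz hx hy; have h4 := hinner_cauchy_schwarz hy hx.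
move: h1 h2; rewrite -!hnorm_sqr; nra.
Qed.

Lemma hnorm_opp x : HA x -> hnorm (- x) = hnorm x.
Proof.
by move=> hx; rewrite /hnorm hinnerNl ?hinnerNr ?opprK//; exact: HA_opp.
Qed.

Lemma hnorm_subC x y : HA x -> HA y -> hnorm (x - y) = hnorm (y - x).
Proof. by move=> hx hy; rewrite -hnorm_opp ?opprB//; exact: HA_sub. Qed.

Lemma hnorm0 : hnorm (0 : nat -> A) = 0.
Proof.
rewrite /hnorm (_ : hinner 0 0 = 0) ?rnorm0 ?sqrtr0//; apply: hinner_eq.
rewrite (_ : series _ = fun=> 0); first exact: cvg_cst.
by apply/funext => n; rewrite /series /= big1// => i _; rewrite mulr0.
Qed.

Lemma rnorm_coord x j : HA x -> rnorm (x j) <= hnorm x.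
Proof.
move=> hx; rewrite -(ler_pXn2r (n := 2)) ?nnegrE ?rnorm_ge0 ?hnorm_ge0//.
rewrite hnorm_sqr -rnorm_cstar; apply: psd_le_norm; first exact: psd_cstar.
rewrite -(subrK (gram x j.+1) (hinner x x)) -addrA.
apply: psdD; first exact: psd_hinner_sub.
by rewrite seriesSr addrK; exact: psd_gram.
Qed.

(** The sequence x restricted to the indices satisfying P, and zero elsewhere. *)
Definition hcut P x : nat -> A := fun j => if P j then x j else 0.

Lemma cutE P x y j : star (hcut P x j) * y j = if P j then star (x j) * y j else 0.
Proof. by rewrite /hcut; case: ifP => // _; rewrite star0 mul0r. Qed.

Lemma cut_cut P Q x : hcut P (hcut Q x) = hcut (predI P Q) x.
Proof. by apply/funext => j; rewrite /hcut /=; case: (P j). Qed.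

Lemma hinner_cutC P x y : hinner (hcut P x) y = hinner x (hcut P y).
Proof.
rewrite /hinner; congr (limn (series _)); apply/funext => j.
by rewrite cutE /hcut; case: ifP; rewrite ?mulr0.
Qed.

Lemma psd_cut_sum P (r : seq nat) x :
  psd (\sum_(j <- r) star (x j) * x j - \sum_(j <- r) star (hcut P x j) * hcut P x j).
Proof.
rewrite -sumrB; apply: psd_sum => i _; rewrite /hcut; case: (P i).
  by rewrite subrr; exact: psd0.
by rewrite mulr0 subr0; exact: psd_cstar.
Qed.

Lemma HA_cut P x : HA x -> HA (hcut P x).
Proof.
move=> hx; apply: cvgn_cauchy => e e0; have [N HN] := cvgn_is_cauchy hx e0.
exists N => n m Nn nm; apply: le_lt_trans (HN n m Nn nm).
rewrite !sub_series_geq//; apply: psd_le_norm; first exact: psd_gram.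
exact: psd_cut_sum.
Qed.

Lemma hinner_cut_psd P x : HA x -> psd (hinner x x - hinner (hcut P x) (hcut P x)).
Proof.
move=> hx; apply: (@psd_closed _ _ (fun n => gram x n - gram (hcut P x) n)).
  by apply: cvgB; apply: hinner_cvg => //; exact: HA_cut.
by move=> n; exact: psd_cut_sum.
Qed.

Lemma hnorm_cut P x : HA x -> hnorm (hcut P x) <= hnorm x.
Proof.
move=> hx; rewrite ler_sqrt ?rnorm_ge0//; apply: psd_le_norm.
  by apply: psd_hinner; exact: HA_cut.
exact: hinner_cut_psd.
Qed.

Lemma hnorm_cut_sub P Q x : HA x -> {subset P <= Q} -> hnorm (hcut P x) <= hnorm (hcut Q x).
Proof.
move=> hx PQ; rewrite (_ : hcut P x = hcut P (hcut Q x)); first by apply: hnorm_cut; exact: HA_cut.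
rewrite cut_cut; apply/funext => j; rewrite /hcut /=; case: ifP => //= Pj.
by rewrite -[Q j]/(j \in Q) PQ.
Qed.

(** The part of x from the index m on; its norm is the distance from x to the
sequences supported below m. *)
Definition htail (m : nat) := hcut (fun j => m <= j)%N.

Lemma tail_cvg0 x (e : R) : HA x -> 0 < e ->
  exists N, forall m, (N <= m)%N -> hnorm (htail m x) < e.
Proof.
move=> hx e0; have e2 : 0 < e ^+ 2 / 2 by rewrite divr_gt0// exprn_gt0.
have [N HN] := cvgn_is_cauchy hx e2.
exists N => m Nm; rewrite -(ltr_pXn2r (n := 2)) ?nnegrE ?hnorm_ge0 ?(ltW e0)//.
rewrite hnorm_sqr; apply: (@le_lt_trans _ _ (e ^+ 2 / 2)); last first.
  by rewrite ltr_pdivrMr// ltr_pMr ?exprn_gt0// ltr1n.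
have ht : HA (htail m x) by exact: HA_cut.
apply: (cvgn_rnorm_le (N := m) (hinner_cvg ht ht)) => n mn.
apply/ltW; apply: le_lt_trans (HN m n Nm mn).
rewrite sub_series_geq// (_ : series _ n = \sum_(m <= j < n) star (x j) * x j)//.
rewrite /series /= (big_cat_nat (n := m))//= big_nat big1 ?add0r.
  by rewrite !big_nat; apply: eq_bigr => i /andP[mi _]; rewrite /htail /hcut mi.
by move=> i /andP[_ im]; rewrite /htail /hcut leqNgt im mulr0.
Qed.

End Module.

(** * Measures of noncompactness for a distance function *)

Section AbstractMeasures.
Variables (R : realType) (T : Type) (H : set T) (d : T -> T -> \bar R).
Implicit Types (E S : set T).

Lemma infinite_two_points S : infinite_set S -> exists x y, [/\ S x, S y & x <> y].
Proof.
move=> Sinf; have [x Sx] := infinite_setN0 Sinf.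
apply: contrapT => nxy; apply: Sinf; apply: (@sub_finite_set _ _ [set x]) => // y Sy.
by apply: contrapT => xy; apply: nxy; exists x, y; split => // yx; apply: xy.
Qed.

Lemma infinite_pigeonhole (n : nat) (F : 'I_n -> set T) S : infinite_set S ->
  (forall x, S x -> exists j, F j x) -> exists j, infinite_set (S `&` F j).
Proof.
move=> Sinf SF; apply: contrapT => nF; apply: Sinf.
apply: (@sub_finite_set _ _ (\bigcup_j (S `&` F j))).
  by move=> x Sx; have [j Fjx] := SF x Sx; exists j.
apply: bigcup_finite; first exact: finite_finset.
by move=> j _; apply: contrapT => h; apply: nF; exists j.
Qed.

Lemma istratescu_le_kuratowski E : (istratescu_mnc d E <= kuratowski_mnc d E)%E.
Proof.
apply: ge_ereal_sup => _ [->|[e /= [e0 [S [SE Sinf Sd]]] <-]].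
  by apply: le_ereal_inf_tmp => _ [e [e0 _] <-]; rewrite lee_fin ltW.
apply: le_ereal_inf_tmp => _ [e' [e'0 [n [F [EF Fd]]]] <-].
have [|j /infinite_two_points[x [y [[Sx Fx] [Sy Fy] xy]]]] := @infinite_pigeonhole n F S Sinf.
  by move=> x /SE; rewrite EF => -[j _ Fjx]; exists j.
apply: le_trans (Sd x y Sx Sy xy) _; apply/ltW; apply: le_lt_trans (Fd j).
by apply: ereal_sup_ubound; exists (x, y).
Qed.

Lemma hausdorff_ge0 E : (0 <= hausdorff_mnc H d E)%E.
Proof. by apply: le_ereal_inf_tmp => _ [e [e0 _] <-]; rewrite lee_fin ltW. Qed.

Lemma kuratowski_le_hausdorff E : E `<=` H ->
  (forall x y c (r : R), H x -> H y -> H c -> 0 < r -> (d x c < r%:E)%E ->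
    (d y c < r%:E)%E -> (d x y <= (2 * r)%:E)%E) ->
  (kuratowski_mnc d E <= 2%:E * hausdorff_mnc H d E)%E.
Proof.
move=> EH dtri; rewrite -lee_pdivrMl//; apply: le_ereal_inf_tmp => _ [e [e0 [n [c [Hc Ec]]]] <-].
rewrite lee_pdivrMl// -EFinM; apply/lee_addgt0Pr => del del0.
apply: ereal_inf_lbound; exists (2 * e + del) => //; split.
  by rewrite addr_gt0// mulr_gt0.
exists n, (fun j => [set x | E x /\ (d x (c j) < e%:E)%E]); split.
  apply/seteqP; split=> [x Ex|x [j _ []//]].
  by have [j xj] := Ec x Ex; exists j.
move=> j; apply: (@le_lt_trans _ _ (2 * e)%:E); last by rewrite lte_fin ltrDl.
apply: ge_ereal_sup => _ [[x y] /= [[Ex xc] [Ey yc]] <-].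
by apply: (dtri x y (c j)) => //; exact: EH.
Qed.

End AbstractMeasures.


(** * Troitsky's seminorms *)

Section Troitsky.
Variables (R : realType) (A : cstarAlgType R).
Variables (X : nat -> nat -> A) (Phi : nat -> {scalar A}).
Hypotheses (admX : admissible X) (stPhi : forall k, is_state (Phi k)).
Implicit Types (x y : nat -> A) (r s : R).

(** The coefficients whose squares are summed in [troitsky]. *)
Definition tcoef k x i : R := rnorm (Phi k (hinner x (X i))).

Lemma tcoef_ge0 k x i : 0 <= tcoef k x i.
Proof. exact: rnorm_ge0. Qed.

Lemma troitsky_leP x r : 0 <= r ->
  (troitsky X Phi x <= r%:E)%E <->
  forall k n, \sum_(k <= i < n) tcoef k x i ^+ 2 <= r ^+ 2.
Proof.
move=> r0.
have -> : r%:E = sqrte (r ^+ 2)%:E by rewrite EFin_expe sqrte_sqr gee0_abs.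
rewrite /troitsky lee_sqrt ?lee_fin ?sqr_ge0//; split=> [H k n|H].
  rewrite -lee_fin -sumEFin; apply: le_trans H.
  apply: (@le_trans _ _ (\sum_(k <= i <oo) (tcoef k x i ^+ 2)%:E)%E).
    by apply: nneseries_lim_ge => i _ _; rewrite lee_fin sqr_ge0.
  by apply: ereal_sup_ubound; exists k.
apply: ge_ereal_sup => _ [k _ <-].
apply: lime_le; first by apply: is_cvg_nneseries => i _ _; rewrite lee_fin sqr_ge0.
by apply: nearW => n; rewrite sumEFin lee_fin; exact: H.
Qed.

Lemma troitsky_ge0 x : (0 <= troitsky X Phi x)%E.
Proof. exact: sqrte_ge0. Qed.

Lemma tcoef_le_troitsky k i x : (k <= i)%N -> ((tcoef k x i)%:E <= troitsky X Phi x)%E.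
Proof.
move=> ki; have := troitsky_ge0 x.
case E : (troitsky X Phi x) => [r| |] //; last by move=> _; rewrite leey.
rewrite !lee_fin => r0.
have /(troitsky_leP x r0)/(_ k i.+1) : (troitsky X Phi x <= r%:E)%E by rewrite E.
rewrite big_nat_recr//= => h.
rewrite -(ler_pXn2r (n := 2)) ?nnegrE ?tcoef_ge0//; apply: le_trans h.
by rewrite lerDr sumr_ge0// => j _; rewrite sqr_ge0.
Qed.

(** Minkowski's inequality, from (a + b)^2 <= (1 + s / r) a^2 + (1 + r / s) b^2. *)
Lemma troitskyD x y r s : HA x -> HA y -> 0 < r -> 0 < s ->
  (troitsky X Phi x <= r%:E)%E -> (troitsky X Phi y <= s%:E)%E ->
  (troitsky X Phi (x + y)%R <= (r + s)%:E)%E.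
Proof.
move=> hx hy r0 s0 /(troitsky_leP x (ltW r0)) Hx /(troitsky_leP y (ltW s0)) Hy.
have [hX _ _ _] := admX.
apply/troitsky_leP; first exact: addr_ge0 (ltW r0) (ltW s0).
move=> k n; have h1 := Hx k n; have h2 := Hy k n.
apply: (@le_trans _ _ (\sum_(k <= i < n) ((1 + s / r) * tcoef k x i ^+ 2 +
    (1 + r / s) * tcoef k y i ^+ 2))).
  apply: ler_sum => i _.
  have h : tcoef k (x + y) i <= tcoef k x i + tcoef k y i.
    by rewrite /tcoef hinnerDl// linearD; exact: ler_rnormD.
  have a0 := tcoef_ge0 k x i; have b0 := tcoef_ge0 k y i.
  have := tcoef_ge0 k (x + y) i.
  move: (tcoef k x i) (tcoef k y i) (tcoef k (x + y) i) h a0 b0 => a b c cab a0 b0 c0.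
  apply: (@le_trans _ _ ((a + b) ^+ 2)); first by rewrite ler_pXn2r ?nnegrE ?addr_ge0.
  rewrite -subr_ge0.
  have -> : (1 + s / r) * a ^+ 2 + (1 + r / s) * b ^+ 2 - (a + b) ^+ 2 =
     (s * a - r * b) ^+ 2 / (r * s) by field; rewrite !gt_eqF.
  by rewrite divr_ge0 ?sqr_ge0 ?mulr_ge0 ?ltW.
rewrite big_split /= -!mulr_sumr.
have -> : (r + s) ^+ 2 = (1 + s / r) * r ^+ 2 + (1 + r / s) * s ^+ 2.
  by field; rewrite !gt_eqF.
by apply: lerD; apply: ler_wpM2l => //; rewrite addr_ge0// divr_ge0// ltW.
Qed.

Lemma tcoef_sqr_le k x i : HA x ->
  tcoef k x i ^+ 2 <= complex.Re (Phi k (hinner x (X i) * hinner (X i) x)).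
Proof.
move=> hx; have [hX _ _ _] := admX.
by rewrite -(hinner_star hx (hX i)); exact: state_cauchy_schwarz.
Qed.

Lemma Re_sum (I : Type) (r : seq I) (F : I -> R[i]) :
  complex.Re (\sum_(i <- r) F i) = \sum_(i <- r) complex.Re (F i).
Proof. by elim/big_rec2: _ => // i y1 y2 _ <-; case: (F i) y2 => a b [c d]. Qed.

Lemma Re_state k (a : A) : complex.Re (Phi k a) <= rnorm a.
Proof.
apply: le_trans (state_norm (stPhi k) a); rewrite /rnorm normc_def /=.
apply: le_trans (ler_norm _) _.
by rewrite -sqrtr_sqr ler_sqrt ?lerDl ?sqr_ge0// addr_ge0 ?sqr_ge0.
Qed.

Lemma tcoef_sum_le k x m n : HA x ->
  \sum_(m <= i < n) tcoef k x i ^+ 2 <=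
  rnorm (\sum_(m <= i < n) hinner x (X i) * hinner (X i) x).
Proof.
move=> hx; apply: le_trans (Re_state k _).
by rewrite linear_sum Re_sum; apply: ler_sum => i _; exact: tcoef_sqr_le.
Qed.

Lemma psd_frame_term x i : HA x -> psd (hinner x (X i) * hinner (X i) x).
Proof.
move=> hx; have [hX _ _ _] := admX.
by rewrite -(hinner_star (hX i) hx); exact: psd_cstar.
Qed.

Lemma troitsky_le_hnorm x : HA x -> (troitsky X Phi x <= (hnorm x)%:E)%E.
Proof.
move=> hx; have [hX cvX leX _] := admX.
apply/troitsky_leP; first exact: hnorm_ge0.
move=> k n; apply: le_trans (tcoef_sum_le _ _ _ hx) _; rewrite hnorm_sqr.
set w := fun i => hinner x (X i) * hinner (X i) x.
have pw m n' : psd (\sum_(m <= i < n') w i) by apply: psd_sum => i _; exact: psd_frame_term.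
apply: (@le_trans _ _ (rnorm (limn (series w)))); last first.
  apply: psd_le_norm; last by apply/cposP; exact: leX.
  by apply: (psd_closed (cvX x hx)) => m; exact: pw.
apply: psd_le_norm => //.
apply: (@psd_closed _ _ (fun m => series w (m + maxn k n)%N - \sum_(k <= i < n) w i)).
  apply: cvgB; last exact: cvg_cst.
  by rewrite (cvg_shiftn _ (series w)); exact: cvX.
move=> m; have [kn|nk] := leqP k n; last first.
  by rewrite [X in _ - X]big_geq ?subr0; [exact: pw | exact: ltnW].
rewrite /series /= (@big_cat_nat _ _ _ k) ?leq_addl//; last exact: leq_trans kn (leq_addl _ _).
rewrite (@big_cat_nat _ _ _ n k) ?leq_addl//=.
by rewrite addrA addrAC addrK; apply: psdD; exact: pw.
Qed.

End Troitsky.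

(** * Bounded subsets of free modules are totally bounded *)

(** Finitely many bounded real functions take nearly equal values at each point of
D and at some point of a finite subset of D. *)
Lemma finite_net (R : realType) (U : Type) (I : eqType) (r : seq I) (f : I -> U -> R)
    (B del : R) (D : set U) : 0 < del -> (forall l u, D u -> `|f l u| <= B) ->
  exists C, [/\ finite_set C, C `<=` D & forall u, D u ->
    exists2 c, C c & forall l, l \in r -> `|f l u - f l c| < del].
Proof.
move=> del0; elim: r D => [|l r IH] D DB.
  have [[u0 Du0]|D0] := pselect (D !=set0); last first.
    by exists set0; split => // u Du; case: D0; exists u.
  exists [set u0]; split => // [u -> //|u _].
  by exists u0.
pose cell (k : nat) := [set u | D u /\ Num.truncn ((f l u + B) / del) = k].
(* The values of f l are sorted into cells of width del. *)
have /choice[C HC] k : exists C, [/\ finite_set C, C `<=` cell k & forall u, cell k u ->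
    exists2 c, C c & forall l, l \in r -> `|f l u - f l c| < del].
  by apply: IH => l' u [Du _]; exact: DB.
pose K := Num.truncn ((B + B) / del).
exists (\bigcup_(k in `I_K.+1) C k); split.
- by apply: bigcup_finite => // k _; have [] := HC k.
- by move=> u [k _]; have [_ /(_ u) + _] := HC k => /[apply] -[].
have pos u : D u -> 0 <= (f l u + B) / del.
  move=> /(DB l); rewrite ler_norml => /andP[h _].
  by rewrite divr_ge0 ?(ltW del0)//; lra.
move=> u Du; set k := Num.truncn ((f l u + B) / del).
have [_ Csub /(_ u (conj Du erefl))[c Cc Hc]] := HC k.
exists c.
  exists k => //=; rewrite ltnS; apply: le_truncn.
  by rewrite ler_pM2r ?invr_gt0// lerD2r; have := DB l u Du; rewrite ler_norml => /andP[].
move=> l'; rewrite in_cons => /orP[/eqP->|]; last exact: Hc.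
have [Dc ck] := Csub c Cc.
have /andP[u1 u2] := truncn_itv (pos u Du); have /andP[c1 c2] := truncn_itv (pos c Dc).
move: u1 u2 c1 c2; rewrite ck -/k !ler_pdivlMr// !ltr_pdivrMr// -natr1 mulrDl mul1r => *.
by rewrite ltr_norml; apply/andP; split; lra.
Qed.

Section TotallyBounded.
Variables (R : realType) (A : cstarAlgType R).
Variables (X : nat -> nat -> A) (Phi : nat -> {scalar A}).
Hypotheses (admX : admissible X) (stPhi : forall k, is_state (Phi k)).
Implicit Types (x y : nat -> A) (r s : R).

Local Notation tc := (tcoef X Phi).

Lemma sum_tail_mono (F : nat -> R) (N M n : nat) : (forall i, 0 <= F i) -> (N <= M)%N ->
  \sum_(M <= i < n) F i <= \sum_(N <= i < n) F i.
Proof.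
move=> F0 NM; have [Mn|nM] := leqP M n.
  by rewrite (@big_cat_nat _ _ _ M N n)//= lerDr sumr_ge0.
by rewrite big_geq ?(ltnW nM)// sumr_ge0.
Qed.

Lemma tcoef_sqrD k x y i : HA x -> HA y ->
  tc k (x + y) i ^+ 2 <= 2 * tc k x i ^+ 2 + 2 * tc k y i ^+ 2.
Proof.
move=> hx hy; have [hX _ _ _] := admX.
have h : tc k (x + y) i <= tc k x i + tc k y i.
  by rewrite /tcoef hinnerDl// linearD; exact: ler_rnormD.
have := tcoef_ge0 X Phi k (x + y) i; move: h.
move: (tc k (x + y) i) (tc k x i) (tc k y i) => c a b h c0.
have := sqr_ge0 (a - b); have := mulr_ge0 c0 c0.
have : c ^+ 2 <= (a + b) ^+ 2 by rewrite ler_pXn2r ?nnegrE// (le_trans c0).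
nra.
Qed.

(** The tails of the coefficients of g a are uniformly small for |a| <= K and for
all states. *)
Lemma tail_rscale (g : nat -> A) (K e : R) : HA g -> 0 <= K -> 0 < e -> exists N, forall a,
  rnorm a <= K -> forall k n, \sum_(N <= i < n) tc k (rscale g a) i ^+ 2 <= e.
Proof.
move=> hg K0 e0; have [hX cvX _ _] := admX.
have K1 : 0 < K ^+ 2 + 1 by rewrite ltr_wpDl// sqr_ge0.
have [N HN] := cvgn_is_cauchy (cvX g hg) (divr_gt0 e0 K1).
exists N => a aK k n; have [Nn|nN] := leqP N n; last first.
  by rewrite big_geq ?(ltnW nN)// ltW.
have hga : HA (rscale g a) by exact: HA_rscale.
have := tcoef_sum_le admX stPhi k N n hga; move/le_trans; apply.
have -> : \sum_(N <= i < n) hinner (rscale g a) (X i) * hinner (X i) (rscale g a) =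
    star a * (\sum_(N <= i < n) hinner g (X i) * hinner (X i) g) * a.
  rewrite mulr_sumr mulr_suml; apply: eq_bigr => i _.
  by rewrite hinnerZl// hinnerZr// !mulrA.
apply: le_trans (rnormM _ _) _; apply: le_trans (ler_wpM2r (rnorm_ge0 _) (rnormM _ _)) _.
have := HN N n (leqnn N) Nn; rewrite sub_series_geq// rnorm_star.
set W := \sum_(N <= i < n) _; move: (rnorm W) (rnorm_ge0 W) => w w0.
rewrite ltr_pdivlMr// => h; have a0 := rnorm_ge0 a.
have : rnorm a ^+ 2 <= K ^+ 2 by rewrite ler_pXn2r ?nnegrE.
nra.
Qed.

Lemma HA_sum (J : Type) (r : seq J) (g : J -> nat -> A) :
  (forall j, HA (g j)) -> HA (\sum_(j <- r) g j).
Proof. by move=> hg; apply: big_ind => //; [exact: HA0 | exact: HA_add]. Qed.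

Lemma tail_rscale_sum (J : Type) (r : seq J) (g : J -> nat -> A) (K e : R) :
  (forall j, HA (g j)) -> 0 <= K -> 0 < e -> exists N, forall a : J -> A,
  (forall j, rnorm (a j) <= K) -> forall k n,
  \sum_(N <= i < n) tc k (\sum_(j <- r) rscale (g j) (a j)) i ^+ 2 <= e.
Proof.
move=> hg K0; have [hX _ _ _] := admX; elim: r e => [|j r IH] e e0.
  exists 0%N => a _ k n; rewrite big_nil big1 ?ltW// => i _.
  have h0 : hinner 0 (X i) = 0 :> A.
    have h00 : HA (0 : nat -> A) by exact: HA0.
    have := hinnerDl h00 h00 (hX i); rewrite addr0 => /eqP.
    by rewrite eq_sym -subr_eq0 addrK => /eqP.
  by rewrite /tcoef h0 linear0 rnorm0 expr0n.
have e4 : 0 < e / 4 by rewrite divr_gt0.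
have [N1 H1] := IH _ e4; have [N2 H2] := tail_rscale (hg j) K0 e4.
exists (maxn N1 N2) => a aK k n.
have {}H1 := le_trans (sum_tail_mono n (fun i => sqr_ge0 _) (leq_maxl N1 N2)) (H1 a aK k n).
have {}H2 := le_trans (sum_tail_mono n (fun i => sqr_ge0 _) (leq_maxr N1 N2)) (H2 (a j) (aK j) k n).
rewrite big_cons.
apply: (@le_trans _ _ (\sum_(maxn N1 N2 <= i < n) (2 * tc k (rscale (g j) (a j)) i ^+ 2 +
   2 * tc k (\sum_(j <- r) rscale (g j) (a j)) i ^+ 2))).
  apply: ler_sum => i _; apply: tcoef_sqrD; first exact: HA_rscale.
  by apply: HA_sum => l; exact: HA_rscale.
rewrite big_split /= -!mulr_sumr; lra.
Qed.

(** If the tails of the sums defining the seminorm are uniformly small on the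
differences of points of a bounded set, only the indices i, k < N matter, and
[finite_net] applies to the real and imaginary parts of the functionals
y |-> phi_k <y, x_i>. *)
Lemma uniform_tail_tot_bounded (D : set (nat -> A)) (M e : R) : D `<=` @HA R A ->
  (forall y, D y -> hnorm y <= M) -> 0 < e ->
  (forall e, 0 < e -> exists N, forall y z, D y -> D z -> forall k n,
     \sum_(N <= i < n) tc k (y - z) i ^+ 2 <= e) ->
  exists C, [/\ finite_set C, C `<=` D & forall y, D y ->
    exists2 c, C c & (troitsky X Phi (y - c)%R <= e%:E)%E].
Proof.
move=> DH DM e0 Dtail; have [hX _ _ X1] := admX.
have e2 : 0 < e ^+ 2 / 2 by rewrite divr_gt0// exprn_gt0.
have [N HN] := Dtail _ e2.
pose f (l : 'I_N * 'I_N * bool) (y : nat -> A) : R :=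
  let z := Phi l.1.1 (hinner y (X l.1.2)) in if l.2 then complex.Re z else complex.Im z.
(* Small enough for at most N terms, each bounded by 2 del^2. *)
pose del := e / (2 * (N%:R + 1)).
have N1 : 0 < N%:R + 1 :> R by rewrite ltr_wpDl.
have del0 : 0 < del by rewrite divr_gt0// mulr_gt0.
have fB l y : D y -> `|f l y| <= M.
  move=> Dy; apply: (@le_trans _ _ (rnorm (Phi l.1.1 (hinner y (X l.1.2))))).
    rewrite -(ler_pXn2r (n := 2)) ?nnegrE ?rnorm_ge0// real_normK ?num_real// rnormcE.
    by rewrite /f; case: l.2; rewrite ?lerDl ?lerDr sqr_ge0.
  apply: le_trans (state_norm (stPhi _) _) _.
  apply: le_trans (hinner_cauchy_schwarz (DH y Dy) (hX _)) _.
  apply: le_trans (DM y Dy); rewrite -[leRHS]mulr1.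
  by apply: ler_wpM2l => //; exact: hnorm_ge0.
have [C [Cfin CD HC]] := finite_net (enum {: 'I_N * 'I_N * bool}) del0 fB.
exists C; split => // y Dy; have [c Cc Hc] := HC y Dy.
exists c => //; have Dc := CD c Cc.
apply/troitsky_leP; first exact: ltW.
have small k i : (k < N)%N -> (i < N)%N -> tc k (y - c) i ^+ 2 <= 2 * del ^+ 2.
  move=> kN iN; pose l b : 'I_N * 'I_N * bool := (Ordinal kN, Ordinal iN, b).
  have := Hc (l true) (mem_enum _ _); have := Hc (l false) (mem_enum _ _).
  rewrite /tcoef hinnerBl ?linearB ?rnormcE; [|exact: DH|exact: DH|exact: hX].
  rewrite /f /=; case: (Phi k (hinner y (X i))) => a b.
  case: (Phi k (hinner c (X i))) => a' b' /=.
  rewrite !ltr_norml => /andP[h1 h2] /andP[h3 h4]; nra.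
have smallsum k n : (n <= N)%N -> \sum_(k <= i < n) tc k (y - c) i ^+ 2 <= e ^+ 2 / 2.
  move=> nN; have [kn|nk] := leqP k n; last by rewrite big_geq ?(ltnW nk)// ltW.
  apply: (@le_trans _ _ (\sum_(k <= i < n) 2 * del ^+ 2)).
    rewrite !big_nat; apply: ler_sum => i /andP[ki iN]; apply: small; last exact: leq_trans iN nN.
    by apply: leq_ltn_trans ki _; exact: leq_trans iN nN.
  rewrite sumr_const_nat -[leLHS]mulr_natl.
  have nk : (n - k)%:R <= N%:R :> R by rewrite ler_nat; apply: leq_trans nN; exact: leq_subr.
  apply: (@le_trans _ _ (N%:R * (2 * del ^+ 2))).
    by apply: ler_wpM2r => //; rewrite mulr_ge0// sqr_ge0.
  have -> : N%:R * (2 * del ^+ 2) = (N%:R / (N%:R + 1) ^+ 2) * (e ^+ 2 / 2) :> R.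
    by rewrite /del; field; rewrite gt_eqF.
  rewrite -[leRHS]mul1r; apply: ler_wpM2r; first exact: ltW.
  rewrite ler_pdivrMr ?exprn_gt0// mul1r.
  have : 0 <= N%:R :> R by []. 
  nra.
move=> k n; have [nN|Nn] := leqP n N.
  by apply: le_trans (smallsum k n nN) _; rewrite ler_pdivrMr// ler_pMr ?exprn_gt0// ler1n.
have [Nk|kN] := leqP N k.
  apply: le_trans (sum_tail_mono n (fun i => sqr_ge0 _) Nk) _.
  apply: le_trans (HN y c Dy Dc k n) _.
  by rewrite ler_pdivrMr// ler_pMr ?exprn_gt0// ler1n.
rewrite (@big_cat_nat _ _ _ N)//=; [|exact: ltnW|exact: ltnW].
have := smallsum k N (leqnn N); have := HN y c Dy Dc k n; lra.
Qed.

Lemma free_fg_tail (L : set (nat -> A)) (M : R) : L `<=` @HA R A -> free_fg L ->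
  forall e, 0 < e -> exists N, forall y z, L y -> L z -> hnorm y <= M -> hnorm z <= M ->
    forall k n, \sum_(N <= i < n) tc k (y - z) i ^+ 2 <= e.
Proof.
move=> LH [n [T [TD TZ TL [c [C [c0 C0 TC]]]]]] e e0.
have T0 : T 0 = 0.
  by have := TD 0 0; rewrite addr0 => /eqP; rewrite eq_sym -subr_eq0 addrK => /eqP.
have TN u : T (- u) = - T u.
  have -> : - u = rscale u (-1) by apply/funext => j; rewrite /rscale mulrN mulr1.
  by rewrite TZ -rscaleN1.
(* The standard basis of A^n; its images under T generate L. *)
pose eb (j : 'I_n) : 'I_n -> A := fun i => if i == j then 1 else 0.
have uE (u : 'I_n -> A) : u = \sum_(j <- enum 'I_n) rscale (eb j) (u j).
  apply/funext => i; rewrite fct_sumE big_enum /= (bigD1 i)//= /rscale /eb eqxx mul1r.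
  by rewrite big1 ?addr0// => j ji; rewrite eq_sym (negbTE ji) mul0r.
have TE (u : 'I_n -> A) : T u = \sum_(j <- enum 'I_n) rscale (T (eb j)) (u j).
  by rewrite {1}[u]uE (big_morph T TD T0); apply: eq_bigr => j _; exact: TZ.
have ucoord (u : 'I_n -> A) j : rnorm (u j) <= fin_norm u.
  rewrite -(ler_pXn2r (n := 2)) ?nnegrE ?rnorm_ge0 ?sqrtr_ge0//.
  rewrite sqr_sqrtr ?rnorm_ge0// -rnorm_cstar; apply: psd_le_norm; first exact: psd_cstar.
  by rewrite (bigD1 j)//= addrAC subrr add0r; apply: psd_sum => i _; exact: psd_cstar.
have hT u : HA (T u) by apply: LH; rewrite -TL; exists u.
have M0 : 0 <= 2 * `|M| / c by rewrite divr_ge0// ?mulr_ge0// ltW.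
have [N HN] := tail_rscale_sum (enum 'I_n) (fun j => hT (eb j)) M0 e0.
exists N => y z; rewrite -TL => -[u _ <-] [v _ <-] uM vM k m.
rewrite -TN -TD TE; apply: HN => j; apply: le_trans (ucoord _ j) _.
rewrite ler_pdivlMr// mulrC; have /andP[h _] := TC (u - v).
apply: le_trans h _; rewrite TD TN.
apply: le_trans (hnorm_triangle (hT u) (HA_opp (hT v))) _; rewrite hnorm_opp//.
by have := ler_norm M; lra.
Qed.

Lemma hausdorff_le_lambda (E : set (nat -> A)) : E `<=` @HA R A -> hbounded E ->
  (hausdorff_mnc (@HA R A) (fun x y => troitsky X Phi (x - y)%R) E <= lambda E)%E.
Proof.
move=> EH [M EM]; apply: le_ereal_inf_tmp => _ [eta /= [eta0 [L [[LH _ _ _ _] Lfree Leta]]] <-].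
apply/lee_addgt0Pr => e e0; apply: ereal_inf_lbound.
exists (eta + e) => //; split; first exact: addr_gt0.
(* Points of L that are within eta of E belong to this bounded set. *)
pose D := [set y | L y /\ hnorm y <= M + eta].
have [||||C [Cfin CD HC]] := @uniform_tail_tot_bounded D (M + eta) (e / 2).
- by move=> y [/LH].
- by move=> y [].
- exact: divr_gt0.
- move=> e' e'0; have [N HN] := free_fg_tail (M + eta) LH Lfree e'0.
  by exists N => y z [Ly yM] [Lz zM]; exact: HN.
have [n [c Cc]] : exists n (c : 'I_n -> nat -> A), C = range c.
  have /finite_seqP[s ->] := Cfin.
  exists (size s), (fun j => nth 0 s j); apply/seteqP; split => y /=.
    move=> ys; have iy : (index y s < size s)%N by rewrite index_mem.
    by exists (Ordinal iy) => //=; exact: nth_index.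
  by move=> [j _ <-]; exact: mem_nth.
exists n, c; split.
  by move=> j; apply/LH; have [] : D (c j) by apply: CD; rewrite Cc; exists j.
move=> x Ex.
have [_ [y Ly <-]] : exists2 z, [set (hnorm (x - y)%R)%:E | y in L] z & (z < eta%:E)%E.
  apply: ereal_inf_lt; apply: le_lt_trans Leta; apply: ereal_sup_ubound.
  by exists x.
rewrite lte_fin => xy; have hx := EH x Ex; have hy := LH y Ly.
have [|c' Cc' yc] := HC y.
  split => //; rewrite -(subrK x y); apply: le_trans (hnorm_triangle (HA_sub hy hx) hx) _.
  by rewrite hnorm_subC// addrC lerD// ?EM// ltW.
move: Cc'; rewrite Cc => -[j _ cj]; exists j; rewrite cj.
have hc : HA c' by apply/LH; have [] : D c' by apply: CD; rewrite Cc; exists j.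
rewrite -(subrK y x) -addrA; apply: (@le_lt_trans _ _ (eta + e / 2)%:E).
  apply: troitskyD => //; [exact: HA_sub|exact: HA_sub|exact: divr_gt0|].
  by apply: le_trans (troitsky_le_hnorm admX stPhi (HA_sub hx hy)) _; rewrite lee_fin ltW.
by rewrite lte_fin ltrD2l ltr_pdivrMr// ltr_pMr// ltr1n.
Qed.

End TotallyBounded.

(** * Coordinate submodules and escaping sequences *)

Section Coordinates.
Variables (R : realType) (A : cstarAlgType R).
Implicit Types (x y : nat -> A) (m : nat).

(** The free submodule of sequences supported in the first m coordinates. *)
Definition coords m : set (nat -> A) := [set x | forall j, (m <= j)%N -> x j = 0].

Lemma coords_cvg m x y : coords m x ->
  series (fun j => star (x j) * y j) @ \oo --> \sum_(0 <= j < m) star (x j) * y j.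
Proof.
move=> xm; apply/cvgn_rnormP => e e0; exists m => n mn.
rewrite /series /= (@big_cat_nat _ _ _ m)//= [X in _ + X - _]big_nat [X in _ + X - _]big1.
  by rewrite addr0 subrr rnorm0.
by move=> j /andP[mj _]; rewrite xm// star0 mul0r.
Qed.

Lemma HA_coords m x : coords m x -> HA x.
Proof. by move=> xm; apply: cvgP; exact: coords_cvg xm. Qed.

Lemma hinner_coords m x y : coords m x -> hinner x y = \sum_(0 <= j < m) star (x j) * y j.
Proof. by move=> xm; apply: hinner_eq; exact: coords_cvg. Qed.

Lemma coords_hilbert m : hilbert_submodule (coords m).
Proof.
split.
- by move=> x; exact: HA_coords.
- by [].
- by move=> x y xm ym j mj /=; rewrite -[(x + y) j]/(x j + y j) xm// ym// addr0.
- by move=> x a xm j mj; rewrite /rscale xm// mul0r.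
- move=> x hx H j mj; apply: rnorm_eq0; apply/eqP; rewrite eq_le rnorm_ge0 andbT.
  apply/ler_addgt0Pr => e e0; rewrite add0r; have [y ym /ltW] := H e e0.
  apply: le_trans; have hy := HA_coords ym.
  by apply: le_trans (rnorm_coord j (HA_sub hx hy)); rewrite -[(x - y) j]/(x j - y j) ym// subr0.
Qed.

(** A vector of A^m extended by zeros to a sequence. *)
Definition extend0 m (u : 'I_m -> A) : nat -> A :=
  fun j => if insub j is Some i then u i else 0.

Lemma extend0E m (u : 'I_m -> A) (i : 'I_m) : extend0 u i = u i.
Proof. by rewrite /extend0 valK. Qed.

Lemma extend0_coords m (u : 'I_m -> A) : coords m (extend0 u).
Proof. by move=> j mj; rewrite /extend0 insubF// ltnNge mj. Qed.

Lemma hnorm_extend0 m (u : 'I_m -> A) : hnorm (extend0 u) = fin_norm u.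
Proof.
rewrite /hnorm /fin_norm (hinner_coords _ (extend0_coords u)) big_mkord.
by under eq_bigr do rewrite extend0E.
Qed.

Lemma coords_free m : free_fg (coords m).
Proof.
exists m, (@extend0 m); split.
- move=> u v; apply/funext => j; rewrite -[RHS]/(extend0 u j + extend0 v j) /extend0.
  by case: insubP => //; rewrite addr0.
- move=> u a; apply/funext => j; rewrite /rscale /extend0.
  by case: insubP => //; rewrite mul0r.
- apply/seteqP; split=> [_ [u _ <-]|x xm]; first exact: extend0_coords.
  exists (fun i : 'I_m => x i) => //; apply/funext => j; rewrite /extend0.
  by case: insubP => [i _ <-//|]; rewrite -leqNgt => /xm ->.
- by exists 1, 1; split => // u; rewrite mul1r hnorm_extend0 lexx.
Qed.

(** The submodules [coords] compete in the definition of [lambda]. *)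
Lemma far_point (E : set (nat -> A)) (eta : R) m : E `<=` @HA R A -> 0 < eta ->
  (eta%:E < lambda E)%E -> exists x, E x /\ eta < hnorm (htail m x).
Proof.
move=> EH eta0; rewrite ltNge => /negP H; apply: contrapT => nx; apply: H.
apply/lee_addgt0Pr => e e0; apply: ereal_inf_lbound.
exists (eta + e) => //; split; first exact: addr_gt0.
exists (coords m); split; [exact: coords_hilbert | exact: coords_free |].
apply: (@le_lt_trans _ _ eta%:E); last by rewrite lte_fin ltrDl.
apply: ge_ereal_sup => _ [x Ex <-]; apply: ereal_inf_le.
exists (hnorm (htail m x))%:E; last first.
  by rewrite lee_fin leNgt; apply/negP => xm; apply: nx; exists x.
exists (hcut (fun j : nat => (j < m)%N) x).
  by move=> j mj; rewrite /hcut ltnNge mj.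
have -> // : x - hcut (fun j : nat => (j < m)%N) x = htail m x.
apply/funext => j.
rewrite -[LHS]/(x j - hcut (fun j : nat => (j < m)%N) x j) /htail /hcut [(m <= j)%N]leqNgt.
by case: (j < m)%N; rewrite ?subrr ?subr0.
Qed.

End Coordinates.

Section Separation.
Variables (R : realType) (A : cstarAlgType R).
Implicit Types (x y : nat -> A).

Local Notation gram x := (series (fun j => star (x j) * x j)).

(** Vectors of norm at most 1 supported in consecutive blocks of coordinates: each
term <x, X_i><X_i, x> is below the part of <x, x> in the i-th block. *)
Lemma block_admissible (X : nat -> nat -> A) (m : nat -> nat) :
  (m 0 = 0)%N -> (forall n, (m n < m n.+1)%N) ->
  (forall i, HA (X i)) -> (forall i, hnorm (X i) <= 1) ->
  (forall i, hcut (fun j => m i <= j < m i.+1)%N (X i) = X i) ->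
  admissible X.
Proof.
move=> m0 mS hX X1 XB.
have mmono : {homo m : i j / (i <= j)%N}.
  by apply: homo_leq => [//|j i k|i]; [exact: leq_trans | exact: ltnW].
have mge n : (n <= m n)%N by elim: n => // n IH; exact: leq_ltn_trans IH (mS n).
pose w x i := hinner x (X i) * hinner (X i) x.
have pw x i : HA x -> psd (w x i).
  by move=> hx; rewrite /w -(hinner_star (hX i) hx); exact: psd_cstar.
have w_block x i : HA x -> psd ((gram x (m i.+1) - gram x (m i)) - w x i).
  move=> hx; set B := (fun j => m i <= j < m i.+1)%N.
  have hBx : HA (hcut B x) by exact: HA_cut.
  have E1 : hinner (X i) x = hinner (X i) (hcut B x) by rewrite -hinner_cutC XB.
  have E2 : hinner (hcut B x) (hcut B x) = gram x (m i.+1) - gram x (m i).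
    have Bm : coords (m i.+1) (hcut B x).
      by move=> j mj; rewrite /hcut /B ltnNge mj andbF.
    rewrite (hinner_coords _ Bm) sub_series_geq ?(ltnW (mS i))//.
    rewrite (@big_cat_nat _ _ _ (m i)) ?(ltnW (mS i))//=.
    rewrite big_nat big1 ?add0r => [|j /andP[_ jm]].
      by rewrite !big_nat; apply: eq_bigr => j jm; rewrite /hcut /B jm.
    by rewrite /hcut /B leqNgt jm mulr0.
  rewrite /w -(hinner_star (hX i) hx) E1 -E2 -[X in psd (X - _)]scale1r.
  apply: (@hinner_cauchy_schwarz_psd _ _ (X i) (hcut B x) 1) => //; apply: psd_sc_sub.
    by rewrite hinner_star.
  by rewrite -hnorm_sqr expr_le1// hnorm_ge0.
have wsum x n n' : HA x -> (n <= n')%N ->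
    psd ((gram x (m n') - gram x (m n)) - \sum_(n <= i < n') w x i).
  move=> hx nn; rewrite -(telescope_sumr (fun i => gram x (m i)) nn) -sumrB.
  by apply: psd_sum => i _; exact: w_block.
have cvw x : HA x -> cvgn (series (w x)).
  move=> hx; apply: cvgn_cauchy => e e0; have [N HN] := cvgn_is_cauchy hx e0.
  exists N => n n' Nn nn; rewrite sub_series_geq//.
  apply: (@le_lt_trans _ _ (rnorm (gram x (m n') - gram x (m n)))).
    apply: psd_le_norm; last exact: wsum.
    by apply: psd_sum => i _; exact: pw.
  by apply: HN; [exact: leq_trans Nn (mge n) | exact: mmono].
split=> [//|x hx|x hx|//]; first exact: (cvw x hx).
apply/cposP.
apply: (@psd_closed _ _ (fun n => hinner x x - series (w x) n)).
  by apply: cvgB; [exact: cvg_cst | exact: cvw].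
move=> n; rewrite -(subrK (gram x (m n)) (hinner x x)) -addrA.
apply: psdD; first exact: psd_hinner_sub.
have := wsum x 0%N n hx (leq0n n).
by rewrite m0 [X in _ - X - _]/series /= [X in _ - X - _]big_geq// subr0.
Qed.

Lemma rnorm_sub_ge (V : normedZmodType R[i]) (u v : V) : rnorm u - rnorm v <= rnorm (u - v).
Proof. by rewrite lerBlDr; apply: le_trans (ler_rnormD _ _); rewrite subrK. Qed.

(** If eta < lambda E, the set E contains a sequence escaping to infinity along the
coordinates, and some Troitsky seminorm sees at x_n all but del of its norm
beyond the index m n. *)
Lemma separating_seminorm (E : set (nat -> A)) (eta del : R) : E `<=` @HA R A ->
  0 < del < eta -> (eta%:E < lambda E)%E ->
  exists X Phi (x : nat -> nat -> A) (m : nat -> nat),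
  [/\ admissible X, forall k, @is_state R A (Phi k), forall n, E (x n),
      (forall n, (n <= m n)%N) /\ (forall j n, (j < n)%N -> hnorm (htail (m n) (x j)) < del) &
      forall n y, HA y ->
        ((eta - del - hnorm (htail (m n) y))%:E <= troitsky X Phi (x n - y)%R)%E].
Proof.
move=> EH /andP[del0 deleta] El; have eta0 : 0 < eta by exact: lt_trans deleta.
have /choice[xs Hxs] := fun m => far_point m EH eta0 El.
have /choice[cutN HcutN] m : exists N, (m < N)%N /\ hnorm (htail N (xs m)) < del.
  have [N HN] := tail_cvg0 (EH _ (Hxs m).1) del0.
  by exists (maxn N m.+1); rewrite leq_maxr; split => //; apply: HN; exact: leq_maxl.
(* m n is the start of the n-th block, and xs (m n) is far from the sequences
   supported before it. *)
pose m n := iter n cutN 0%N.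
have mS n : (m n < m n.+1)%N by exact: (HcutN (m n)).1.
have mge n : (n <= m n)%N by elim: n => // n IH; exact: leq_ltn_trans IH (mS n).
have mmono : {homo m : i j / (i <= j)%N}.
  by apply: homo_leq => [//|j i k|i]; [exact: leq_trans | exact: ltnW].
pose x n := xs (m n).
have hx n : HA (x n) by apply: EH; exact: (Hxs _).1.
pose B n := fun j => (m n <= j < m n.+1)%N.
pose z n := hcut (B n) (x n).
have hz n : HA (z n) by exact: HA_cut.
have zn n : eta - del < hnorm (z n).
  have h1 : eta < hnorm (htail (m n) (x n)) by exact: (Hxs _).2.
  have h2 : hnorm (htail (m n.+1) (x n)) < del by exact: (HcutN _).2.
  have E1 : htail (m n) (x n) = z n + htail (m n.+1) (x n).
    apply/funext => j; rewrite -[RHS]/(z n j + htail (m n.+1) (x n) j) /z /htail /hcut /B.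
    have [mj|jm] := leqP (m n.+1) j; last by rewrite andbT addr0.
    by rewrite andbF add0r (leq_trans _ mj)// ltnW.
  move: h1; rewrite E1 => h1.
  have ht : HA (htail (m n.+1) (x n)) by exact: HA_cut.
  by have := hnorm_triangle (hz n) ht; lra.
have z0 n : 0 < hnorm (z n) by apply: lt_trans (zn n); rewrite subr_gt0.
pose X n := rscale (z n) ((hnorm (z n))^-1%:C *: 1).
have hX n : HA (X n) by exact: HA_rscale.
have XE n y : HA y -> hinner y (X n) = (hnorm (z n))^-1%:C *: hinner y (z n).
  by move=> hy; rewrite hinnerZr// -scalerAr mulr1.
have X1 n : hnorm (X n) = 1.
  rewrite /hnorm XE// hinnerZl// star_sc -scalerAl mul1r.
  rewrite !rnormZR ger0_norm ?invr_ge0 ?hnorm_ge0// -hnorm_sqr.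
  by rewrite mulrA -expr2 -exprMn mulVf ?expr1n ?sqrtr1// gt_eqF.
have XB n : hcut (B n) (X n) = X n.
  apply/funext => j; rewrite /X /rscale /z /hcut; case: (B n j) => //.
  by rewrite mul0r.
have /choice[Phi HPhi] n := exists_state (psd_hinner (hz n)).
exists X, Phi, x, m; split.
- by apply: (@block_admissible X m) => // i; rewrite X1.
- by move=> k; exact: (HPhi k).1.
- by move=> n; exact: (Hxs _).1.
- split => // j n jn; apply: le_lt_trans (HcutN (m j)).2.
  apply: hnorm_cut_sub => //.
  by move=> i; rewrite !unfold_in; apply: leq_trans; exact: (mmono j.+1 n).
- move=> n y hy; apply: le_trans (tcoef_le_troitsky _ _ _ (leqnn n)).
  rewrite lee_fin /tcoef hinnerBl// linearB; apply: le_trans (rnorm_sub_ge _ _).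
  have stn := (HPhi n).1.
  apply: lerB.
    apply: ltW; apply: lt_le_trans (zn n) _.
    rewrite -{1}(XB n) -hinner_cutC -/(z n) XE// scalarZ (HPhi n).2 -hnorm_sqr.
    rewrite -rmorphM /= rnormR expr2 mulrA mulVf ?gt_eqF// mul1r.
    exact: ler_norm.
  apply: le_trans (state_norm stn _) _.
  rewrite -{1}(XB n) -hinner_cutC.
  have hBy : HA (hcut (B n) y) by exact: HA_cut.
  apply: le_trans (hinner_cauchy_schwarz hBy (hX n)) _.
  rewrite X1 mulr1; apply: hnorm_cut_sub => // j.
  by rewrite !unfold_in => /andP[].
Qed.

End Separation.

(** * Comparison of the measures of noncompactness *)

Section StarMeasures.
Variables (R : realType) (A : cstarAlgType R).
Implicit Types (x y : nat -> A) (E : set (nat -> A)).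

Lemma troitskyN (X : nat -> nat -> A) (Phi : nat -> {scalar A}) x :
  admissible X -> HA x -> troitsky X Phi (- x) = troitsky X Phi x.
Proof.
move=> [hX _ _ _] hx; rewrite /troitsky.
suff E k i : rnorm (Phi k (hinner (- x) (X i))) = rnorm (Phi k (hinner x (X i))).
  by under eq_fun do under eq_eseriesr do rewrite E.
by rewrite hinnerNl// linearN rnormN.
Qed.

Lemma troitsky0 (X : nat -> nat -> A) (Phi : nat -> {scalar A}) :
  admissible X -> (forall k, is_state (Phi k)) -> troitsky X Phi 0 = 0%E.
Proof.
move=> aX sP; apply/eqP; rewrite eq_le troitsky_ge0 andbT.
by have := troitsky_le_hnorm aX sP (@HA0 R A); rewrite hnorm0.
Qed.

(** The zero system; it makes the suprema over all systems range over a nonempty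
set. *)
Lemma admissible0 : admissible (fun=> 0 : nat -> A).
Proof.
apply: (@block_admissible R A (fun=> 0) id) => // [i|i|i].
- exact: HA0.
- by rewrite hnorm0.
- by apply/funext => j; rewrite /hcut; case: ifP.
Qed.

Lemma mnc_star_ge0 mu E : (forall d, (0 <= mu d E)%E) -> (0 <= @mnc_star R A mu E)%E.
Proof.
move=> mu0; have [phi [sphi _]] := exists_state (psd0 A).
apply: le_trans (mu0 _) _; apply: ereal_sup_ubound.
by exists (fun=> 0), (fun=> phi); split => //; exact: admissible0.
Qed.

Lemma istratescu_ge0 (T : Type) (d : T -> T -> \bar R) (E : set T) :
  (0 <= istratescu_mnc d E)%E.
Proof. by apply: ereal_sup_ubound; left. Qed.

Lemma le_of_separation (l y : \bar R) : (0 <= y)%E ->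
  (forall eta del : R, 0 < del < eta -> (eta%:E < l)%E -> ((eta - del - del)%:E <= y)%E) ->
  (l <= y)%E.
Proof.
move=> y0 H; rewrite leNgt; apply/negP => yl.
have [r ry] : exists r, y = r%:E.
  by case: y y0 yl {H} => [r _ _|_|//]; [exists r | rewrite ltNge leey].
subst y; rewrite lee_fin in y0.
have [eta reta etal] : exists2 eta, r < eta & (eta%:E < l)%E.
  case: l yl {H} => [s|_|//].
    by rewrite lte_fin => rs; exists ((r + s) / 2); rewrite ?lte_fin; lra.
  by exists (r + 1); rewrite ?ltry ?ltrDl.
have d : 0 < (eta - r) / 3 < eta by apply/andP; split; lra.
by have := H eta _ d etal; rewrite lee_fin; lra.
Qed.

Lemma lambda_le_istratescu E : E `<=` @HA R A -> (lambda E <= I_star E)%E.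
Proof.
move=> EH; apply: le_of_separation; first by apply: mnc_star_ge0 => d; exact: istratescu_ge0.
move=> eta del del_eta El; have [ed0|ed0] := leP (eta - del - del) 0.
  apply: (@le_trans _ _ 0%E); first by rewrite lee_fin.
  by apply: mnc_star_ge0 => d; exact: istratescu_ge0.
have [X [Phi [x [m [aX sPhi xE [_ mdel] xsep]]]]] := separating_seminorm EH del_eta El.
have hx n : HA (x n) by exact: EH.
have far j n : (j < n)%N -> ((eta - del - del)%:E <= troitsky X Phi (x n - x j)%R)%E.
  move=> jn; apply: le_trans (xsep n (x j) (hx j)).
  by rewrite lee_fin lerD2l lerN2 ltW// mdel.
have far2 j n : j != n -> ((eta - del - del)%:E <= troitsky X Phi (x n - x j)%R)%E.
  rewrite neq_ltn => /orP[|nj]; first exact: far.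
  rewrite -troitskyN ?opprB//; [exact: far | exact: HA_sub].
apply: (@le_trans _ _ (istratescu_mnc (fun x y => troitsky X Phi (x - y)) E)); last first.
  by apply: ereal_sup_ubound; exists X, Phi.
apply: ereal_sup_ubound; right; exists (eta - del - del) => //; split => //.
exists (range x); split.
- by move=> _ [n _ <-].
- have xinj : injective x.
    move=> i j xij; apply/eqP; apply: contraT => /far2; rewrite xij subrr troitsky0//.
    by rewrite lee_fin leNgt ed0.
  have /card_eqPle[_ le] := inj_card_eq (f := x) (A := setT) (in2W xinj).
  by move=> /(card_le_finite le); exact: infinite_nat.
- move=> _ _ [i _ <-] [j _ <-] xij; apply: far2; apply/eqP => ij; apply: xij.
  by rewrite ij.
Qed.

Lemma lambda_le_hausdorff E : E `<=` @HA R A -> (lambda E <= chi_star E)%E.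
Proof.
move=> EH; apply: le_of_separation; first by apply: mnc_star_ge0 => d; exact: hausdorff_ge0.
move=> eta del del_eta El.
have [X [Phi [x [m [aX sPhi xE [mge _] xsep]]]]] := separating_seminorm EH del_eta El.
have [del0 _] := andP del_eta.
apply: (@le_trans _ _ (hausdorff_mnc (@HA R A) (fun x y => troitsky X Phi (x - y)) E)); last first.
  by apply: ereal_sup_ubound; exists X, Phi.
apply: le_ereal_inf_tmp => _ [e [e0 [n [c [Hc Ec]]]] <-].
have /choice[N HN] j : exists N, forall k, (N <= k)%N -> hnorm (htail k (c j)) < del.
  exact: tail_cvg0.
(* Beyond m K all centres c j are negligible, and x K lies in one of the balls. *)
pose K := \max_j N j.
have [j xcj] := Ec (x K) (xE K).
apply: le_trans (ltW xcj); apply: le_trans (xsep K (c j) (Hc j)).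
rewrite lee_fin lerD2l lerN2 ltW//; apply: HN.
by apply: leq_trans (mge K); exact: leq_bigmax.
Qed.

Lemma hausdorff_star_le_lambda E : E `<=` @HA R A -> hbounded E -> (chi_star E <= lambda E)%E.
Proof.
move=> EH Eb; apply: ge_ereal_sup => _ [X [Phi [aX sPhi ->]]].
exact: hausdorff_le_lambda.
Qed.

Lemma istratescu_star_le_kuratowski E : (I_star E <= alpha_star E)%E.
Proof.
apply: ge_ereal_sup => _ [X [Phi [aX sPhi ->]]].
apply: le_trans (istratescu_le_kuratowski _ _) _.
by apply: ereal_sup_ubound; exists X, Phi.
Qed.

Lemma kuratowski_star_le_hausdorff E : E `<=` @HA R A ->
  (alpha_star E <= 2%:E * chi_star E)%E.
Proof.
move=> EH; apply: ge_ereal_sup => _ [X [Phi [aX sPhi ->]]].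
apply: (@le_trans _ _ (2%:E * hausdorff_mnc (@HA R A) (fun x y => troitsky X Phi (x - y)%R) E)%E).
  apply: kuratowski_le_hausdorff => // x y c r hx hy hc r0 xc yc.
  have yc' : (troitsky X Phi (c - y)%R <= r%:E)%E.
    by rewrite -opprB (troitskyN _ aX (HA_sub hy hc)); exact: ltW.
  have -> : 2 * r = r + r by rewrite mulrDl mul1r.
  have -> : x - y = (x - c) + (c - y) by rewrite addrA subrK.
  exact: (troitskyD aX (HA_sub hx hc) (HA_sub hc hy) r0 r0 (ltW xc) yc').
apply: lee_wpmul2l => //; apply: ereal_sup_ubound.
by exists X, Phi.
Qed.

End StarMeasures.

Local Open Scope ereal_scope.

Theorem corollary3p7 (R : realType) (A : cstarAlgType R) (E : set (nat -> A))
    (EH : E `<=` @HA R A) (Ebounded : hbounded E) :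
  [/\ chi_star E = lambda E,
      lambda E <= I_star E,
      I_star E <= alpha_star E,
      alpha_star E <= 2%:E * chi_star E &
      2%:E * chi_star E = 2%:E * lambda E].
Proof.
have chiE : chi_star E = lambda E.
  by apply/eqP; rewrite eq_le hausdorff_star_le_lambda// lambda_le_hausdorff.
split => //; first exact: lambda_le_istratescu.
- exact: istratescu_star_le_kuratowski.
- exact: kuratowski_star_le_hausdorff.
- by rewrite chiE.
Qed.
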